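(* Let $\Omega$, $a$, $f$ be as in the context, assume $a\in C^1(\Omega)$, $\frac{\partial a}{\partial s}(u,s)>0$ for all $(u,s)\in\Omega$, and $a_+(u)=+\infty$ for all $u\in[0,1]$. Then the map $a_+:[0,1]\to[0,\infty]$ is (trivially) continuous, $\sigma_r=\sigma_s$, $\alpha_\sigma=0$ for every $\sigma\ge 0$, and the equation $\mathbf u_t=(a(\mathbf u,\mathbf u_x))_x+f(\mathbf u)$ has a classic travelling wave moving at speed $\sigma$ if and only if $\sigma\ge\sigma_r=\sigma_s$.
   Context: $\Omega=\{(u,s)\in\mathbb R^2: u\in[0,1],\ \omega_-(u)<s<\omega_+(u)\}$, where $\omega_+:[0,1]\to(0,\infty]$ is lower semicontinuous and $\omega_-=-\omega_+$. The flux $a:\Omega\to\mathbb R$ is continuous, $a(u,-s)=-a(u,s)$, and $s\mapsto a(u,s)$ is increasing for every $u$. Put $a_\pm(u)=\lim_{s\to\omega_\pm(u)}a(u,s)\in[-\infty,\infty]$; it is assumed that $a_+(u)=\infty$ whenever $\omega_+(u)<\infty$. The reaction term satisfies $f\in C^1[0,1]$, $f(0)=f(1)=0$, $f(u)>0$ for $u\in(0,1)$. A classic travelling wave moving at speed $\sigma\in\mathbb R$ is a solution $\mathbf u(t,x)=u(x+\sigma t)$ where $u\in C^2(\mathbb R)$ is strictly increasing, takes values in $[0,1]$, satisfies $(u,u')\in\Omega$ on $\mathbb R$, $u(-\infty)=0$, $u(+\infty)=1$, and $(a(u,u'))'-\sigma u'+f(u)=0$ on $\mathbb R$. Let $\mathcal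 D=\{(u,v)\in[0,1]\times\mathbb R: a_-(u)<v<a_+(u)\}$ and let $g:\mathcal D\to\mathbb R$ be defined by $a(u,g(u,v))=v$. For $\sigma\ge0$, $(\alpha_\sigma,1]$ (with $\alpha_\sigma\in[0,1)$) denotes the maximal interval to the left of $1$ on which there is a (unique) function $V_\sigma\in C((\alpha_\sigma,1])\cap C^1((\alpha_\sigma,1))$ with $V_\sigma(1)=0$, $0<V_\sigma(u)<a_+(u)$ and $\dot V_\sigma(u)=\sigma-\frac{f(u)}{g(u,V_\sigma(u))}$ for $u\in(\alpha_\sigma,1)$; when $\alpha_\sigma=0$, $V_\sigma(0)=\lim_{u\to0^+}V_\sigma(u)$. Define $\sigma_r=\inf\{\sigma>0:\alpha_\sigma=0\text{ and }V_\sigma(0)=0\}$. Let $\mathcal H(u,V)=\frac1{g(u,V)}$ if $0<V<a_+(u)$ and $\mathcal H(u,V)=0$ if $V\ge a_+(u)$. When $a_+$ is continuous, for each $\sigma\ge0$ let $\mathcal V_\sigma\in C([0,1])\cap C^1((0,1))$ be the unique function, positive on $(0,1)$, with $\dot{\mathcal V}_\sigma=\sigma-f(u)\mathcal H(u,\mathcal V_\sigma)$ on $(0,1)$ and $\mathcal V_\sigma(1)=0$. Define $\sigma_s=\min\{\sigma\ge0:\mathcal V_\sigma(0)=0\}$. *)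

(* Defs.v *)
(* Stdlib reals with Coquelicot.  Functions on subsets of R or R^2 are total
   functions whose values off the subset are never used. *)
From Stdlib Require Export Reals ClassicalEpsilon.
From Coquelicot Require Export Coquelicot.
Open Scope R_scope.

Definition I01 (u : R) : Prop := 0 <= u <= 1.

(* Difference-quotient derivative of [f : D -> R] at [x]: one-sided at the
   endpoints of an interval [D]. *)
Definition derive_within (D : R -> Prop) (f : R -> R) (x l : R) : Prop :=
  filterlim (fun y => (f y - f x) / (y - x)) (within D (locally' x)) (locally l).

Definition C1_01 (f : R -> R) : Prop :=
  exists f' : R -> R,
    (forall u, I01 u -> derive_within I01 f u (f' u)) /\ continuous_on I01 f'.

Definition C1_open (lo hi : R) (V : R -> R) : Prop :=
  forall u, lo < u < hi -> ex_derive V u /\ continuous (Derive V) u.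

Definition C2_R (u : R -> R) : Prop :=
  forall x, ex_derive u x /\ ex_derive (Derive u) x
            /\ continuous (Derive (Derive u)) x.

Definition lsc_01 (h : R -> Rbar) : Prop :=
  forall u, I01 u -> forall c : Rbar, Rbar_lt c (h u) ->
    within I01 (locally u) (fun v => Rbar_lt c (h v)).

Definition usc_01 (h : R -> Rbar) : Prop :=
  forall u, I01 u -> forall c : Rbar, Rbar_lt (h u) c ->
    within I01 (locally u) (fun v => Rbar_lt (h v) c).

(* Continuity on [0,1] for the order topology of [-oo,+oo], whose subbase is the
   set of open rays. *)
Definition Rbar_continuous_01 (h : R -> Rbar) : Prop := lsc_01 h /\ usc_01 h.

(* [w] is omega_+; omega_- is its opposite. *)
Definition Omega (w : R -> Rbar) (p : R * R) : Prop :=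
  I01 (fst p) /\ Rbar_lt (Rbar_opp (w (fst p))) (snd p)
  /\ Rbar_lt (snd p) (w (fst p)).

(* Omega is relatively open in the strip [0,1] x R: the u-derivative is one-sided
   at u = 0 and u = 1, the s-derivative is always two-sided. *)
Definition C1_Omega (w : R -> Rbar) (a : R -> R -> R) : Prop :=
  (exists a_u : R -> R -> R,
     (forall u s, Omega w (u, s) ->
        derive_within (fun v => Omega w (v, s)) (fun v => a v s) u (a_u u s))
     /\ continuous_on (Omega w) (fun p => a_u (fst p) (snd p)))
  /\ (forall u s, Omega w (u, s) -> ex_derive (fun r => a u r) s)
  /\ continuous_on (Omega w) (fun p => Derive (fun r => a (fst p) r) (snd p)).

(* a_+(u), the limit of a(u,s) as s tends to omega_+(u) inside Omega.  It exists
   for [u] in [0,1] by monotonicity. *)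
Definition a_plus (w : R -> Rbar) (a : R -> R -> R) (u : R) : Rbar :=
  epsilon (inhabits p_infty)
    (fun l : Rbar =>
       filterlim (fun s => a u s)
         (within (fun s => Omega w (u, s)) (Rbar_locally' (w u)))
         (Rbar_locally l)).

(* g(u,v), the unique solution s of a(u,s) = v; unspecified when v is not
   strictly between a_-(u) and a_+(u). *)
Definition g (w : R -> Rbar) (a : R -> R -> R) (u v : R) : R :=
  epsilon (inhabits 0) (fun s => Omega w (u, s) /\ a u s = v).

Record standing_assumptions (w : R -> Rbar) (a : R -> R -> R) (f : R -> R)
  : Prop := {
  omega_pos : forall u, I01 u -> Rbar_lt 0 (w u);
  omega_lsc : lsc_01 w;
  flux_continuous : continuous_on (Omega w) (fun p => a (fst p) (snd p));
  flux_odd : forall u s, Omega w (u, s) -> a u (- s) = - a u s;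
  flux_increasing : forall u s r, Omega w (u, s) -> Omega w (u, r) ->
    s < r -> a u s < a u r;
  flux_saturation : forall u, I01 u -> Rbar_lt (w u) p_infty ->
    a_plus w a u = p_infty;
  reaction_C1 : C1_01 f;
  reaction_0 : f 0 = 0;
  reaction_1 : f 1 = 0;
  reaction_pos : forall u, 0 < u < 1 -> 0 < f u
}.

Definition solves_equation (a : R -> R -> R) (f : R -> R) (U : R -> R -> R)
  : Prop :=
  forall t x,
    ex_derive (fun tau => U tau x) t
    /\ ex_derive (fun y => U t y) x
    /\ ex_derive (fun y => a (U t y) (Derive (fun z => U t z) y)) x
    /\ Derive (fun tau => U tau x) t
       = Derive (fun y => a (U t y) (Derive (fun z => U t z) y)) x + f (U t x).

Definition classic_profile (w : R -> Rbar) (a : R -> R -> R) (f : R -> R)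
  (sigma : R) (u : R -> R) : Prop :=
  C2_R u
  /\ (forall x y, x < y -> u x < u y)
  /\ (forall x, 0 <= u x <= 1)
  /\ (forall x, Omega w (u x, Derive u x))
  /\ is_lim u m_infty 0
  /\ is_lim u p_infty 1
  /\ (forall x,
        ex_derive (fun y => a (u y) (Derive u y)) x
        /\ Derive (fun y => a (u y) (Derive u y)) x
           - sigma * Derive u x + f (u x) = 0).

Definition has_classic_travelling_wave (w : R -> Rbar) (a : R -> R -> R)
  (f : R -> R) (sigma : R) : Prop :=
  exists u : R -> R,
    classic_profile w a f sigma u
    /\ solves_equation a f (fun t x => u (x + sigma * t)).

Definition V_solution (w : R -> Rbar) (a : R -> R -> R) (f : R -> R)
  (sigma alpha : R) (V : R -> R) : Prop :=
  continuous_on (fun u => alpha < u <= 1) V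
  /\ C1_open alpha 1 V
  /\ V 1 = 0
  /\ (forall u, alpha < u < 1 ->
        0 < V u /\ Rbar_lt (V u) (a_plus w a u)
        /\ Derive V u = sigma - f u / g w a u (V u)).

(* alpha = alpha_sigma and V = V_sigma on (alpha_sigma, 1]: every solution on an
   interval (beta, 1] is a restriction of V, which expresses both the maximality
   of (alpha, 1] and the uniqueness of V. *)
Definition is_alpha_V (w : R -> Rbar) (a : R -> R -> R) (f : R -> R)
  (sigma alpha : R) (V : R -> R) : Prop :=
  0 <= alpha < 1
  /\ V_solution w a f sigma alpha V
  /\ (forall (beta : R) (W : R -> R), 0 <= beta < 1 ->
        V_solution w a f sigma beta W ->
        alpha <= beta /\ forall u, beta < u <= 1 -> W u = V u).

Definition is_alpha (w : R -> Rbar) (a : R -> R -> R) (f : R -> R)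
  (sigma alpha : R) : Prop :=
  exists V : R -> R, is_alpha_V w a f sigma alpha V.

Definition sigma_r (w : R -> Rbar) (a : R -> R -> R) (f : R -> R) : Rbar :=
  Glb_Rbar (fun sigma =>
    0 < sigma
    /\ exists V : R -> R, is_alpha_V w a f sigma 0 V
                          /\ filterlim V (at_right 0) (locally 0)).

(* Used only for v > 0. *)
Definition calH (w : R -> Rbar) (a : R -> R -> R) (u v : R) : R :=
  if Rbar_lt_dec v (a_plus w a u) then / g w a u v else 0.

Definition calV_solution (w : R -> Rbar) (a : R -> R -> R) (f : R -> R)
  (sigma : R) (V : R -> R) : Prop :=
  continuous_on I01 V
  /\ C1_open 0 1 V
  /\ (forall u, 0 < u < 1 ->
        0 < V u /\ Derive V u = sigma - f u * calH w a u (V u))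
  /\ V 1 = 0.

Definition is_calV (w : R -> Rbar) (a : R -> R -> R) (f : R -> R)
  (sigma : R) (V : R -> R) : Prop :=
  calV_solution w a f sigma V
  /\ (forall W : R -> R, calV_solution w a f sigma W ->
        forall u, I01 u -> W u = V u).

Definition is_min (E : R -> Prop) (m : R) : Prop :=
  E m /\ forall x, E x -> m <= x.

Definition is_sigma_s (w : R -> Rbar) (a : R -> R -> R) (f : R -> R)
  (m : R) : Prop :=
  is_min (fun sigma =>
    0 <= sigma /\ exists V : R -> R, is_calV w a f sigma V /\ V 0 = 0) m.

(* Main.v *)
(* With a_+ = oo the speed problem reduces to V' = sigma - f(u)/g(u,V), V(1) = 0,
   whose right-hand side is increasing in V. Integrated backwards from u = 1 the flow
   is therefore contractive: this gives uniqueness, monotonicity and Lipschitz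
   dependence on sigma, and uniform convergence of approximate solutions of a
   truncated problem (the equation is singular at V = 0), hence existence on [0,1] for
   every sigma >= 0. Consequently {sigma : V_sigma(0) = 0} is an interval [sigma_s, oo);
   it is nonempty because V(u) <= u for large sigma.
   A wave u yields V = a(u,u') as a function of the value of u; it vanishes at both
   ends because u' takes arbitrarily small values near -oo and +oo. Conversely, if
   V(0) = 0, then V and hence g(u,V) are O(u) at 0 and O(1-u) at 1, so that
   x = int du / g(u,V(u)) is a bijection from (0,1) onto R, whose inverse is the wave. *)
From Stdlib Require Import Lra Lia Classical.
From Stdlib Require Ranalysis5.
Require Import Defs.

(** * Comparison principle *)

(** The datum V(1) = 0 lies on the singular line V = 0, and f vanishes at u = 1 as well, so the
    equation cannot be started at u = 1 directly. After truncation, two barriers independent of the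
    truncation decide what survives the limit: from below [- d (1 - u)], and to the right of each
    interior point a line of slope -1 that keeps the approximations away from 0. An estimate at
    level [eta] compares approximations only where the larger one exceeds [eta], where its
    truncation is inactive. The infimum [sigma_r] ranges over positive speeds and [sigma_s] is an
    attained minimum. They agree because the set of speeds is an upward ray, closed by the Lipschitz
    dependence of V(0) on sigma. The positive s-derivative of the flux makes g(u,v) comparable to v
    near v = 0: this bounds f(u)/g(u,u), and makes the coordinate integral diverge at both ends. It
    also gives the C^2 regularity of the wave: u' = g(u,V(u)) is differentiated through the identity
    a(u,u') = V(u) along the wave. *)

Lemma continuous_eps (f : R -> R) (x : R) :
  continuous f x <->
  forall e, 0 < e -> exists d, 0 < d /\
    forall y, Rabs (y - x) < d -> Rabs (f y - f x) < e.
Proof.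
  unfold continuous; split.
  - intros H e He.
    destruct (proj1 (filterlim_locally _ _) H (mkposreal e He)) as [d Hd].
    exists d; split; [apply cond_pos|]. intros y Hy. apply (Hd y), Hy.
  - intros H. apply filterlim_locally. intros e.
    destruct (H e (cond_pos e)) as [d [Hd H']].
    exists (mkposreal d Hd). intros y Hy. apply H', Hy.
Qed.

Lemma is_derive_continuous (f : R -> R) (x l : R) :
  is_derive f x l -> continuous f x.
Proof. intros H. apply (ex_derive_continuous f x). now exists l. Qed.

Lemma derive_nonneg_le (D D' : R -> R) (p q : R) :
  p <= q ->
  (forall x, p < x < q -> is_derive D x (D' x)) ->
  (forall x, p <= x <= q -> continuous D x) ->
  (forall x, p < x < q -> 0 <= D' x) ->
  D p <= D q.
Proof.
  intros Hpq HD Hc Hpos.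
  (* [MVT_gen] may return an endpoint, where nothing is known about [D']; extending it by 0 outside
     the open interval makes its value at [c] nonnegative in every case. *)
  set (df x := if Rlt_dec p x then if Rlt_dec x q then D' x else 0 else 0).
  destruct (MVT_gen D p q df) as [c [_ E]].
  - rewrite Rmin_left, Rmax_right by lra. intros x Hx. unfold df.
    destruct (Rlt_dec p x); [|lra]. destruct (Rlt_dec x q); [|lra]. now apply HD.
  - rewrite Rmin_left, Rmax_right by lra. intros x Hx.
    now apply continuity_pt_filterlim, Hc.
  - assert (0 <= df c) as H0.
    { unfold df. destruct (Rlt_dec p c); [|lra].
      destruct (Rlt_dec c q); [|lra]. apply Hpos; lra. }
    assert (0 <= df c * (q - p)) by (apply Rmult_le_pos; lra). lra.
Qed.

(* The form in which monotonicity of the right-hand side in V is used: D is a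
   difference of two solutions (or of a solution and a supersolution). *)
Lemma comparison (D D' : R -> R) (p q L : R) :
  p < q ->
  (forall u, p <= u < q -> is_derive D u (D' u)) ->
  (forall u, p <= u < q -> 0 < D u -> 0 <= D' u) ->
  filterlim D (at_left q) (locally L) -> L <= 0 ->
  D p <= 0.
Proof.
  intros Hpq HD Hinc Hlim HL.
  destruct (Rle_lt_dec (D p) 0) as [|Hp]; [assumption|exfalso].
  assert (forall u, p <= u < q -> D p <= D u) as Hge.
  { intros u1 Hu1.
    destruct (Rle_lt_dec (D p) (D u1)) as [|Hlt]; [assumption|exfalso].
    (* [S] is the last point up to [u1] where [D] is at least [D p]. As [D S] is positive, [D] is
       nondecreasing just to the right of [S], which yields a later such point. *)
    destruct (completeness (fun x => p <= x <= u1 /\ D p <= D x)) as [S [HS1 HS2]].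
    { exists u1. intros x [Hx _]. lra. }
    { exists p. split; lra. }
    assert (p <= S) as HpS by (apply HS1; split; lra).
    assert (S <= u1) as HSu by (apply HS2; intros x [Hx _]; lra).
    assert (continuous D S) as HcS.
    { apply is_derive_continuous with (D' S), HD. lra. }
    assert (D p <= D S) as HDS.
    { destruct (Rle_lt_dec (D p) (D S)) as [|H]; [assumption|exfalso].
      destruct (proj1 (continuous_eps D S) HcS (D p - D S)) as [d [Hd Hc]]; [lra|].
      assert (S <= S - d) as Hcontra; [|lra].
      apply HS2. intros x [Hx1 Hx2]. destruct (Rle_lt_dec x (S - d)) as [|Hxd]; [assumption|].
      assert (x <= S) by (apply HS1; tauto).
      specialize (Hc x). assert (Rabs (x - S) < d) as Habs by (apply Rabs_def1; lra).
      apply Hc, Rabs_def2 in Habs. lra. }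
    assert (S < u1) as HSlt by (destruct HSu; [assumption|subst; lra]).
    destruct (proj1 (continuous_eps D S) HcS (D S)) as [d [Hd Hc]]; [lra|].
    set (x := S + Rmin (d / 2) (u1 - S)).
    assert (S < x <= u1 /\ x < S + d) as Hx.
    { unfold x. pose proof (Rmin_l (d/2) (u1 - S)). pose proof (Rmin_r (d/2) (u1 - S)).
      assert (0 < Rmin (d / 2) (u1 - S)) by (apply Rmin_pos; lra). lra. }
    assert (D S <= D x).
    { apply derive_nonneg_le with D'; [lra| | |].
      - intros y Hy. apply HD. lra.
      - intros y Hy. apply is_derive_continuous with (D' y), HD. lra.
      - intros y Hy. apply Hinc; [lra|].
        assert (Rabs (y - S) < d) as Habs by (apply Rabs_def1; lra).
        apply Hc, Rabs_def2 in Habs. lra. }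
    assert (x <= S); [|lra]. apply HS1. split; lra. }
  destruct (proj1 (filterlim_locally _ _) Hlim (mkposreal (D p) Hp)) as [d Hd].
  pose proof (cond_pos d) as Hdpos.
  set (y := Rmax p (q - d / 2)).
  assert (p <= y < q /\ q - d < y) as Hy.
  { unfold y. pose proof (Rmax_l p (q - d / 2)). pose proof (Rmax_r p (q - d / 2)).
    assert (Rmax p (q - d / 2) < q) by (apply Rmax_lub_lt; lra). lra. }
  assert (Rabs (y - q) < d) as Hb by (apply Rabs_def1; lra).
  specialize (Hd y Hb (proj2 (proj1 Hy))). change (Rabs (D y - L) < D p) in Hd. apply Rabs_def2 in Hd.
  specialize (Hge y (proj1 Hy)). lra.
Qed.

Lemma continuous_at_left (D : R -> R) (q : R) :
  continuous D q -> filterlim D (at_left q) (locally (D q)).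
Proof.
  intros H. apply filterlim_filter_le_1 with (2 := H).
  intros P HP. now apply filter_le_within.
Qed.

Lemma comparison_continuous (D D' : R -> R) (p q : R) :
  p <= q ->
  (forall u, p <= u < q -> is_derive D u (D' u)) ->
  (forall u, p <= u < q -> 0 < D u -> 0 <= D' u) ->
  continuous D q -> D q <= 0 ->
  D p <= 0.
Proof.
  intros [Hpq|<-] HD Hinc Hc Hq; [|assumption].
  exact (comparison D D' p q (D q) Hpq HD Hinc (continuous_at_left D q Hc) Hq).
Qed.

(** * Approximate solutions of scalar equations *)

Lemma lipschitz_of_derive (D D' : R -> R) (M : R) :
  (forall x, is_derive D x (D' x)) -> (forall x, Rabs (D' x) <= M) ->
  forall x y, Rabs (D x - D y) <= M * Rabs (x - y).
Proof.
  intros HD HM x y. destruct (MVT_gen D y x D') as [c [_ E]].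
  - intros; apply HD.
  - intros z _. apply continuity_pt_filterlim. exact (is_derive_continuous _ _ _ (HD z)).
  - rewrite E, Rabs_mult. apply Rmult_le_compat_r; [apply Rabs_pos|apply HM].
Qed.

Lemma continuous_comp_2d (H : R -> R -> R) (p q : R -> R) (x : R) :
  continuity_2d_pt H (p x) (q x) -> continuous p x -> continuous q x ->
  continuous (fun y => H (p y) (q y)) x.
Proof.
  intros HH Hp Hq. apply continuity_2d_pt_filterlim in HH.
  exact (continuous_comp_2 p q H x Hp Hq HH).
Qed.

Lemma continuous_Rmin_l (c : R) (x : R) : continuous (Rmin c) x.
Proof.
  apply continuous_eps. intros e He. exists e; split; [assumption|]. intros y Hy.
  apply Rabs_def2 in Hy. apply Rabs_def1; unfold Rmin; repeat destruct Rle_dec; lra.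
Qed.

Lemma continuous_Rmax_l (c : R) (x : R) : continuous (Rmax c) x.
Proof.
  apply continuous_eps. intros e He. exists e; split; [assumption|]. intros y Hy.
  apply Rabs_def2 in Hy. apply Rabs_def1; unfold Rmax; repeat destruct Rle_dec; lra.
Qed.

(* Tonelli's scheme for V' = Phi(u, V), V(1) = 0: with the argument of Phi advanced
   by h, the k-th iterate is already exact on [1 - k h, 1]. *)
Fixpoint tonelli (Phi : R -> R -> R) (h : R) (k : nat) (u : R) : R :=
  match k with
  | O => 0
  | S j => RInt (fun s => Phi s (tonelli Phi h j (Rmin 1 (s + h)))) 1 u
  end.

Lemma tonelli_derive (Phi : R -> R -> R) (h : R) :
  (forall u v, continuity_2d_pt Phi u v) ->
  forall k u, continuous (tonelli Phi h k) u /\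
    is_derive (tonelli Phi h (S k)) u (Phi u (tonelli Phi h k (Rmin 1 (u + h)))).
Proof.
  intros HPhi.
  assert (forall k, (forall u, continuous (tonelli Phi h k) u) -> forall u,
    is_derive (tonelli Phi h (S k)) u (Phi u (tonelli Phi h k (Rmin 1 (u + h))))) as Hstep.
  { intros k Hk u. simpl.
    assert (forall s, continuous (fun s => Phi s (tonelli Phi h k (Rmin 1 (s + h)))) s) as Hc.
    { intros s. apply continuous_comp_2d; [apply HPhi|apply continuous_id|].
      apply (continuous_comp (fun s => Rmin 1 (s + h)) (tonelli Phi h k)); [|apply Hk].
      apply (continuous_comp (fun s => s + h) (Rmin 1)); [|apply continuous_Rmin_l].
      apply (continuous_plus (V := R_NormedModule)); [apply continuous_id|apply continuous_const]. }
    apply (is_derive_RInt (V := R_NormedModule) (fun s => Phi s (tonelli Phi h k (Rmin 1 (s + h)))) _ 1 u); [|apply Hc].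
    apply filter_forall. intros b. apply (RInt_correct (V := R_CompleteNormedModule)).
    apply (ex_RInt_continuous (V := R_CompleteNormedModule)). intros z _. apply Hc. }
  assert (forall k u, continuous (tonelli Phi h k) u) as Hc.
  { induction k as [|k IH]; intros u; [apply continuous_const|].
    exact (is_derive_continuous _ _ _ (Hstep k IH u)). }
  intros k u. split; [apply Hc|]. now apply Hstep.
Qed.

(** Each integration consults the previous iterate only at points advanced by [h], so agreement of
    successive iterates spreads to the left by [h] per step. *)
Lemma tonelli_stable (Phi : R -> R -> R) (h : R) : 0 < h ->
  forall k u, 1 - INR k * h <= u <= 1 -> tonelli Phi h (S k) u = tonelli Phi h k u.
Proof.
  intros Hh. induction k as [|k IH]; intros u Hu.
  - simpl in Hu |- *. replace u with 1 by lra. exact (RInt_point (V := R_CompleteNormedModule) 1 _).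
  - change (RInt (fun s => Phi s (tonelli Phi h (S k) (Rmin 1 (s + h)))) 1 u =
            RInt (fun s => Phi s (tonelli Phi h k (Rmin 1 (s + h)))) 1 u).
    apply RInt_ext. intros s. rewrite Rmin_right, Rmax_left by lra. intros Hs.
    f_equal. apply IH. rewrite S_INR in Hu. split; [|apply Rmin_l].
    assert (0 <= INR k * h) by (apply Rmult_le_pos; [apply pos_INR|lra]).
    apply Rmin_glb; lra.
Qed.

Lemma approximate_solution (Phi : R -> R -> R) (M e : R) :
  (forall u v, continuity_2d_pt Phi u v) -> (forall u v, Rabs (Phi u v) <= M) -> 0 < e ->
  exists V V' : R -> R, V 1 = 0 /\ (forall u, is_derive V u (V' u)) /\
    forall u, 0 <= u <= 1 -> Rabs (V' u - Phi u (V u)) < e.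
Proof.
  intros HPhi HM He.
  assert (0 <= M) as HM0.
  { apply Rle_trans with (2 := HM 0 0), Rabs_pos. }
  destruct (uniform_continuity_2d Phi 0 1 (- M) M (fun x y _ _ => HPhi x y) (mkposreal e He))
    as [d Hd]. simpl in Hd. pose proof (cond_pos d) as Hdpos.
  (* The solution is [M]-Lipschitz, so an advance by [h] changes its value by less than [d]; the
     [+ 1] covers [M = 0]. *)
  set (h := d / (M + 1)).
  assert (0 < h) as Hh by (apply Rdiv_lt_0_compat; lra).
  assert (M * h < d) as HMh.
  { apply Rlt_le_trans with ((M + 1) * h).
    - apply Rmult_lt_compat_r; lra.
    - unfold h. right. field. lra. }
  destruct (INR_archimed h 1 Hh) as [k Hk].
  exists (tonelli Phi h (S k)), (fun u => Phi u (tonelli Phi h k (Rmin 1 (u + h)))).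
  assert (forall u, is_derive (tonelli Phi h (S k)) u
     (Phi u (tonelli Phi h k (Rmin 1 (u + h))))) as HD.
  { intros u. now apply tonelli_derive. }
  assert (tonelli Phi h (S k) 1 = 0) as H1 by exact (RInt_point (V := R_CompleteNormedModule) 1 _).
  split; [assumption|split; [assumption|]].
  pose proof (lipschitz_of_derive _ _ M HD (fun x => HM _ _)) as HL.
  assert (forall w, 0 <= w <= 1 -> - M <= tonelli Phi h (S k) w <= M) as HB.
  { intros w Hw. specialize (HL w 1). rewrite H1, Rminus_0_r in HL.
    assert (Rabs (w - 1) <= 1) by (apply Rabs_le; lra).
    apply Rabs_le_between. eapply Rle_trans; [exact HL|].
    rewrite <- (Rmult_1_r M) at 2. now apply Rmult_le_compat_l. }
  intros u Hu.
  assert (u <= Rmin 1 (u + h) <= 1 /\ Rmin 1 (u + h) <= u + h) as Hw.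
  { split; [split; [apply Rmin_glb; lra|apply Rmin_l]|apply Rmin_r]. }
  (* Since [k h > 1], iterates [k] and [S k] agree on [0,1]: the advanced value is a value of the
     solution itself, at a point at most [h] away. *)
  rewrite <- (tonelli_stable Phi h Hh k (Rmin 1 (u + h))) by lra.
  apply Hd; try lra.
  - apply HB; lra.
  - apply HB; lra.
  - rewrite Rminus_diag, Rabs_R0; lra.
  - apply Rle_lt_trans with (1 := HL _ _). apply Rle_lt_trans with (2 := HMh).
    apply Rmult_le_compat_l; [assumption|]. apply Rabs_le; lra.
Qed.

(** * The truncated problem *)

Lemma is_derive_eps (f : R -> R) (x l : R) :
  is_derive f x l <->
  forall e, 0 < e -> exists d, 0 < d /\
    forall y, Rabs (y - x) < d -> Rabs (f y - f x - l * (y - x)) <= e * Rabs (y - x).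
Proof.
  rewrite is_derive_Reals. split.
  - intros H e He. destruct (H e He) as [d Hd].
    exists d; split; [apply cond_pos|]. intros y Hy.
    destruct (Req_dec y x) as [->|Hyx].
    + rewrite !Rminus_diag, Rmult_0_r, Rminus_0_r, Rabs_R0. lra.
    + specialize (Hd (y - x)). replace (x + (y - x)) with y in Hd by ring.
      replace (f y - f x - l * (y - x)) with (((f y - f x) / (y - x) - l) * (y - x))
        by (field; lra).
      rewrite Rabs_mult. apply Rmult_le_compat_r; [apply Rabs_pos|].
      left. apply Hd; [lra|assumption].
  - intros H e He. destruct (H (e / 2)) as [d [Hd Hf]]; [lra|].
    exists (mkposreal d Hd). simpl. intros h Hh Hhd.
    specialize (Hf (x + h)). replace (x + h - x) with h in Hf by ring.
    replace ((f (x + h) - f x) / h - l) with ((f (x + h) - f x - l * h) / h) by (field; assumption).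
    unfold Rdiv. rewrite Rabs_mult, Rabs_inv.
    assert (0 < Rabs h) by now apply Rabs_pos_lt.
    apply Rle_lt_trans with (e / 2); [|lra].
    apply Rmult_le_reg_r with (Rabs h); [assumption|].
    rewrite Rmult_assoc, Rinv_l, Rmult_1_r by lra. auto.
Qed.

Definition clamp (u : R) : R := Rmax 0 (Rmin 1 u).

Lemma clamp_in (u : R) : 0 <= clamp u <= 1.
Proof. unfold clamp, Rmax, Rmin; repeat destruct Rle_dec; lra. Qed.

Lemma clamp_id (u : R) : 0 <= u <= 1 -> clamp u = u.
Proof. unfold clamp, Rmax, Rmin; repeat destruct Rle_dec; lra. Qed.

Lemma continuous_clamp (u : R) : continuous clamp u.
Proof.
  apply (continuous_comp (Rmin 1) (Rmax 0)); [apply continuous_Rmin_l|apply continuous_Rmax_l].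
Qed.

(* In the application F and G are f and g with u clamped to [0,1], so that no
   one-sided notions are needed. *)
Record regular_data (F : R -> R) (G : R -> R -> R) : Prop := {
  F_continuous : forall u, continuous F u;
  F_nonneg : forall u, 0 <= F u;
  F_bounded : exists B, forall u, F u <= B;
  F_pos : forall u, 0 < u < 1 -> 0 < F u;
  G_continuous : forall u v, continuity_2d_pt G u v;
  G_increasing : forall u v1 v2, v1 < v2 -> G u v1 < G u v2;
  G_0 : forall u, G u 0 = 0
}.

(* The right-hand side sigma - F / G, made bounded and continuous at V = 0, still
   nondecreasing in V; below V = 0 it is nonpositive, which keeps solutions
   nonnegative. *)
Definition truncated_rhs (F : R -> R) (G : R -> R -> R) (sigma d u v : R) : R :=
  sigma * Rmin 1 (Rmax 0 v / d) - F u / Rmax d (G u v).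

(** One [d] is both truncation level and tolerance in the equation, so a single sequence [d -> 0]
    removes both. *)
Definition truncated_approximation (F : R -> R) (G : R -> R -> R) (sigma d : R)
  (V : R -> R) : Prop :=
  exists V' : R -> R, V 1 = 0 /\ (forall u, is_derive V u (V' u)) /\
    forall u, 0 <= u <= 1 -> Rabs (V' u - truncated_rhs F G sigma d u (V u)) < d.

Section TruncatedProblem.

Variables (F : R -> R) (G : R -> R -> R) (sigma : R).
Hypotheses (HFG : regular_data F G) (Hsigma : 0 <= sigma).

Lemma G_le (u v1 v2 : R) : v1 <= v2 -> G u v1 <= G u v2.
Proof.
  intros [H|H]; [left; now apply (G_increasing F G HFG)|rewrite H; apply Rle_refl].
Qed.

Lemma G_pos (u v : R) : 0 < v -> 0 < G u v.
Proof. intros H. rewrite <- (G_0 F G HFG u). now apply (G_increasing F G HFG). Qed.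

Lemma F_div_le (u x y : R) : 0 < x <= y -> F u / y <= F u / x.
Proof.
  intros H. apply Rmult_le_compat_l; [apply (F_nonneg F G HFG)|].
  apply Rinv_le_contravar; lra.
Qed.

Lemma truncated_rhs_nonpos (d u v : R) : 0 < d -> v <= 0 -> truncated_rhs F G sigma d u v <= 0.
Proof.
  intros Hd Hv. unfold truncated_rhs.
  rewrite (Rmax_left 0 v) by lra. unfold Rdiv at 1. rewrite Rmult_0_l, Rmin_right, Rmult_0_r by lra.
  assert (0 <= F u / Rmax d (G u v)); [|lra].
  apply Rmult_le_pos; [apply (F_nonneg F G HFG)|].
  left. apply Rinv_0_lt_compat. pose proof (Rmax_l d (G u v)). lra.
Qed.

(** Comparisons are asymmetric: this upper bound holds for every [v] and serves the smaller
    solution, while the exact formula [truncated_rhs_eq] serves the larger one, which stays away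
    from 0. *)
Lemma truncated_rhs_le (d u v : R) : 0 < d ->
  truncated_rhs F G sigma d u v <= sigma - F u / Rmax d (G u v).
Proof.
  intros Hd. unfold truncated_rhs.
  assert (sigma * Rmin 1 (Rmax 0 v / d) <= sigma * 1); [|lra].
  apply Rmult_le_compat_l; [assumption|apply Rmin_l].
Qed.

Lemma truncated_rhs_eq (d u v : R) : 0 < d -> d <= v -> d <= G u v ->
  truncated_rhs F G sigma d u v = sigma - F u / G u v.
Proof.
  intros Hd Hv HG. unfold truncated_rhs.
  assert (1 <= v / d).
  { apply Rmult_le_reg_r with d; [assumption|]. unfold Rdiv.
    rewrite Rmult_assoc, Rinv_l by lra. lra. }
  rewrite (Rmax_right 0 v), (Rmax_right d), Rmin_left by lra.
  ring.
Qed.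

Lemma truncated_rhs_continuous (d u v : R) : 0 < d ->
  continuity_2d_pt (truncated_rhs F G sigma d) u v.
Proof.
  intros Hd. unfold truncated_rhs. apply continuity_2d_pt_minus.
  - apply continuity_2d_pt_mult; [apply continuity_2d_pt_const|].
    apply (continuity_1d_2d_pt_comp (fun z => Rmin 1 (Rmax 0 z / d)) (fun _ v => v));
      [|apply continuity_2d_pt_id2].
    apply continuity_pt_filterlim.
    apply (continuous_comp (fun z => Rmax 0 z / d) (Rmin 1)); [|apply continuous_Rmin_l].
    apply (continuous_mult (K := R_AbsRing) (Rmax 0) (fun _ => / d)); [apply continuous_Rmax_l|apply continuous_const].
  - apply continuity_2d_pt_mult.
    + apply (continuity_1d_2d_pt_comp F (fun u _ => u)); [|apply continuity_2d_pt_id1].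
      apply continuity_pt_filterlim, (F_continuous F G HFG).
    + apply continuity_2d_pt_inv.
      * apply (continuity_1d_2d_pt_comp (Rmax d) G); [|apply (G_continuous F G HFG)].
        apply continuity_pt_filterlim, continuous_Rmax_l.
      * pose proof (Rmax_l d (G u v)). lra.
Qed.

Lemma truncated_rhs_bounded (d : R) : 0 < d ->
  exists M, forall u v, Rabs (truncated_rhs F G sigma d u v) <= M.
Proof.
  intros Hd. destruct (F_bounded F G HFG) as [B HB]. exists (sigma + B / d). intros u v.
  assert (0 <= sigma * Rmin 1 (Rmax 0 v / d) <= sigma) as H1.
  { split.
    - apply Rmult_le_pos; [assumption|]. apply Rmin_glb; [lra|].
      apply Rmult_le_pos; [apply Rmax_l|]. left; now apply Rinv_0_lt_compat.
    - rewrite <- (Rmult_1_r sigma) at 2. apply Rmult_le_compat_l; [assumption|apply Rmin_l]. }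
  assert (0 <= F u / Rmax d (G u v) <= B / d) as H2.
  { pose proof (Rmax_l d (G u v)). pose proof (F_nonneg F G HFG u). split.
    - apply Rmult_le_pos; [assumption|]. left. apply Rinv_0_lt_compat. lra.
    - apply Rle_trans with (F u / d); [apply F_div_le; lra|].
      apply Rmult_le_compat_r; [left; now apply Rinv_0_lt_compat|apply HB]. }
  unfold truncated_rhs. apply Rabs_le. lra.
Qed.

Lemma truncated_approximation_exists (d : R) : 0 < d ->
  exists V, truncated_approximation F G sigma d V.
Proof.
  intros Hd. destruct (truncated_rhs_bounded d Hd) as [M HM].
  destruct (approximate_solution (truncated_rhs F G sigma d) M d) as [V [V' HV]]; auto.
  - intros u v. now apply truncated_rhs_continuous.
  - now exists V, V'.
Qed.

(** While [V < 0] the truncated right-hand side is nonpositive, so [V' < d]; followed backwards from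
    [V 1 = 0], the solution loses at most [d] per unit of length. *)
Lemma truncated_approximation_lower (d : R) (V : R -> R) : 0 < d ->
  truncated_approximation F G sigma d V ->
  forall u, 0 <= u <= 1 -> - (d * (1 - u)) <= V u.
Proof.
  intros Hd [V' [V1 [HV HV']]] p Hp.
  assert (- V p - d * (1 - p) <= 0); [|lra].
  assert (forall u, is_derive (fun u => - V u - d * (1 - u)) u (- V' u + d)) as HD.
  { intros u. specialize (HV u). auto_derive; [now exists (V' u)|].
    rewrite (is_derive_unique (fun u : R => V u) _ _ HV). ring. }
  apply (comparison_continuous (fun u => - V u - d * (1 - u)) (fun u => - V' u + d) p 1);
    [lra|auto| |exact (is_derive_continuous _ _ _ (HD 1))|lra].
  intros u Hu Hpos.
  assert (0 <= d * (1 - u)) by (apply Rmult_le_pos; lra).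
  assert (truncated_rhs F G sigma d u (V u) <= 0) by (apply truncated_rhs_nonpos; lra).
  specialize (HV' u ltac:(lra)). apply Rabs_def2 in HV'. lra.
Qed.

Lemma G_lower_bound (v : R) : 0 < v ->
  exists d, 0 < d /\ forall u, 0 <= u <= 1 -> d <= G u v.
Proof.
  intros Hv. destruct (continuity_ab_min (fun u => G u v) 0 1) as [m [Hm _]]; [lra| |].
  - intros u _. apply continuity_pt_filterlim.
    apply continuous_comp_2d; [apply (G_continuous F G HFG)|apply continuous_id|apply continuous_const].
  - exists (G m v). split; [now apply G_pos|assumption].
Qed.

(** Where the claimed inequality fails, [W >= - e (1 - u)] forces [V >= eta]. There [V] solves the
    untruncated equation up to [d], and the larger of [e] and [G u (W u)] is at most [G u (V u)], so
    the right-hand sides are ordered. The term [(d + e) (1 - u)] absorbs the two tolerances. *)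
Lemma truncated_approximation_close (eta : R) : 0 < eta ->
  exists d0, 0 < d0 /\ forall d e V W, 0 < d <= d0 -> 0 < e <= d0 ->
    truncated_approximation F G sigma d V -> truncated_approximation F G sigma e W ->
    forall u, 0 <= u <= 1 -> V u <= W u + (d + e) * (1 - u) + eta.
Proof.
  intros Heta. destruct (G_lower_bound eta Heta) as [d1 [Hd1 HG]].
  exists (Rmin d1 eta). split; [now apply Rmin_pos|].
  intros d e V W Hd He HV HW.
  pose proof (Rmin_l d1 eta). pose proof (Rmin_r d1 eta).
  assert (0 < e) as He0 by lra.
  pose proof (truncated_approximation_lower e W He0 HW) as HWlow.
  destruct HV as [V' [V1 [HV HV']]]. destruct HW as [W' [W1 [HW HW']]].
  intros p Hp.
  assert (forall u, is_derive (fun u => V u - W u - (d + e) * (1 - u) - eta) u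
            (V' u - W' u + (d + e))) as HD.
  { intros u. specialize (HV u). specialize (HW u).
    auto_derive; [split; [now exists (V' u)|split; [now exists (W' u)|exact I]]|].
    rewrite (is_derive_unique (fun u : R => V u) _ _ HV), (is_derive_unique (fun u : R => W u) _ _ HW). ring. }
  assert (V p - W p - (d + e) * (1 - p) - eta <= 0); [|lra].
  apply (comparison_continuous (fun u => V u - W u - (d + e) * (1 - u) - eta)
    (fun u => V' u - W' u + (d + e)) p 1);
    [lra|auto| |exact (is_derive_continuous _ _ _ (HD 1))|lra].
  intros u Hu Hpos.
  assert (0 <= (d + e) * (1 - u)) by (apply Rmult_le_pos; lra).
  specialize (HWlow u ltac:(lra)).
  assert (0 <= e * (1 - u) <= (d + e) * (1 - u)).
  { split; [apply Rmult_le_pos|apply Rmult_le_compat_r]; lra. }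
  assert (eta <= V u) as HVeta by lra.
  assert (d1 <= G u (V u)) as HGV.
  { apply Rle_trans with (G u eta); [apply HG; lra|now apply G_le]. }
  specialize (HV' u ltac:(lra)). specialize (HW' u ltac:(lra)).
  rewrite truncated_rhs_eq in HV' by lra.
  pose proof (truncated_rhs_le e u (W u) He0).
  assert (F u / G u (V u) <= F u / Rmax e (G u (W u))).
  { apply F_div_le. split; [apply Rlt_le_trans with (1 := He0), Rmax_l|].
    apply Rmax_lub; [lra|]. apply G_le. lra. }
  apply Rabs_def2 in HV'. apply Rabs_def2 in HW'. lra.
Qed.

End TruncatedProblem.

(** Continuity on the whole line encodes the boundary values at 0 and 1 without one-sided limits. *)
Definition profile_solution (F : R -> R) (G : R -> R -> R) (sigma : R) (V : R -> R) : Prop :=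
  (forall u, continuous V u) /\ V 1 = 0 /\
  forall u, 0 < u < 1 -> 0 < V u /\ is_derive V u (sigma - F u / G u (V u)).

Section ProfileExistence.

Variables (F : R -> R) (G : R -> R -> R) (sigma : R).
Hypotheses (HFG : regular_data F G) (Hsigma : 0 <= sigma).

(** The barrier is the line [p + c - u], of height [c] at [p] and 0 at [p + c]. Where [V + d] lies
    below it, [V] is small, so [F / G] is large and [V' <= -1]; hence the gap cannot close before
    [p + c], where the lower bound [V >= - d] excludes it. *)
Lemma truncated_approximation_positive (p : R) : 0 < p < 1 ->
  exists c d0, 0 < c /\ 0 < d0 /\ forall d V, 0 < d <= d0 ->
    truncated_approximation F G sigma d V -> c - d <= V p.
Proof.
  intros Hp.
  pose proof (F_pos F G HFG p Hp) as HFp.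
  destruct (proj1 (continuous_eps F p) (F_continuous F G HFG p) (F p / 2)) as [r1 [Hr1 HF]]; [lra|].
  (* With [F > F p / 2] and denominator at most [kappa] the quotient is at least [sigma + 2]: one
     unit gives the slope -1, the other pays for the tolerance [d <= 1]. *)
  set (kappa := F p / 2 / (sigma + 2)).
  assert (0 < kappa) as Hk by (apply Rdiv_lt_0_compat; lra).
  destruct (G_continuous F G HFG p 0 (mkposreal kappa Hk)) as [r2 HG]. simpl in HG.
  rewrite (G_0 F G HFG) in HG. pose proof (cond_pos r2) as Hr2.
  set (c := Rmin (Rmin r1 r2) (1 - p) / 2).
  assert (0 < c /\ c < r1 /\ c < r2 /\ c < 1 - p) as Hc.
  { unfold c. pose proof (Rmin_l (Rmin r1 r2) (1 - p)). pose proof (Rmin_r (Rmin r1 r2) (1 - p)).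
    pose proof (Rmin_l r1 r2). pose proof (Rmin_r r1 r2).
    assert (0 < Rmin (Rmin r1 r2) (1 - p)) by (repeat apply Rmin_pos; lra). lra. }
  exists c, (Rmin (kappa / 2) 1). split; [tauto|]. split; [apply Rmin_pos; lra|].
  intros d V Hd HV.
  pose proof (Rmin_l (kappa / 2) 1). pose proof (Rmin_r (kappa / 2) 1).
  pose proof (truncated_approximation_lower F G sigma HFG d V ltac:(lra) HV) as Hlow.
  destruct HV as [V' [V1 [HV HV']]].
  assert (forall u, is_derive (fun u => p + c - u - V u - d) u (- 1 - V' u)) as HD.
  { intros u. specialize (HV u). auto_derive; [now exists (V' u)|].
    rewrite (is_derive_unique (fun u : R => V u) _ _ HV). ring. }
  assert (p + c - p - V p - d <= 0); [|lra].
  apply (comparison_continuous (fun u => p + c - u - V u - d) (fun u => -1 - V' u) p (p + c));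
    [lra|auto| |exact (is_derive_continuous _ _ _ (HD _))|].
  - intros u Hu Hpos.
    assert (F p / 2 < F u) as HFu.
    { assert (Rabs (u - p) < r1) as Habs by (apply Rabs_def1; lra).
      apply HF, Rabs_def2 in Habs. lra. }
    assert (G u (V u) < kappa) as HGu.
    { destruct (Rle_lt_dec (V u) 0) as [H1|H1].
      - pose proof (G_le F G HFG u (V u) 0 H1) as H2. rewrite (G_0 F G HFG) in H2. lra.
      - assert (Rabs (G u (V u) - 0) < kappa) as Habs; [|apply Rabs_def2 in Habs; lra].
        apply HG; apply Rabs_def1; lra. }
    assert (sigma + 2 <= F u / Rmax d (G u (V u))).
    { replace (sigma + 2) with (F p / 2 / kappa) by (unfold kappa; field; lra).
      apply Rle_trans with (F u / kappa).
      - apply Rmult_le_compat_r; [left; now apply Rinv_0_lt_compat|lra].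
      - apply (F_div_le F G HFG). split; [apply Rlt_le_trans with d; [lra|apply Rmax_l]|].
        apply Rmax_lub; lra. }
    pose proof (truncated_rhs_le F G sigma Hsigma d u (V u) ltac:(lra)).
    specialize (HV' u ltac:(lra)). apply Rabs_def2 in HV'. lra.
  - specialize (Hlow (p + c) ltac:(lra)).
    assert (d * (1 - (p + c)) <= d * 1) by (apply Rmult_le_compat_l; lra). lra.
Qed.

Definition approximating_sequence (n : nat) : R -> R :=
  epsilon (inhabits (fun _ => 0)) (truncated_approximation F G sigma (/ (INR n + 1))).

Lemma approximating_sequence_spec (n : nat) :
  truncated_approximation F G sigma (/ (INR n + 1)) (approximating_sequence n).
Proof.
  unfold approximating_sequence. apply epsilon_spec.
  apply truncated_approximation_exists; try assumption.
  apply Rinv_0_lt_compat. pose proof (pos_INR n). lra.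
Qed.

Lemma inv_INR_small (e : R) : 0 < e ->
  exists N, forall n, (N <= n)%nat -> 0 < / (INR n + 1) <= e.
Proof.
  intros He. destruct (INR_archimed e 1 He) as [N HN].
  exists N. intros n Hn. apply le_INR in Hn. pose proof (pos_INR n) as Hpos.
  split; [apply Rinv_0_lt_compat; lra|].
  apply Rmult_le_reg_r with (INR n + 1); [lra|]. rewrite Rinv_l by lra.
  assert (INR N * e <= INR n * e) by (apply Rmult_le_compat_r; lra). lra.
Qed.

(** The approximations converge on [0,1] only; [clamp] extends the limit by constants, so continuity
    at 0 and 1 is two-sided. *)
Definition profile (u : R) : R :=
  real (Lim_seq (fun n => approximating_sequence n (clamp u))).

Lemma profile_uniform_limit :
  CVU_dom (fun n u => approximating_sequence n (clamp u)) (fun _ => True).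
Proof.
  apply CVU_dom_cauchy. intros [e He].
  (* Budget: [eta = e / 4] and two truncation levels of at most [e / 4] each. The estimate is then
     used in both orders of [n] and [m]. *)
  destruct (truncated_approximation_close F G sigma HFG Hsigma (e / 4) ltac:(lra)) as [d0 [Hd0 Hclose]].
  destruct (inv_INR_small (Rmin d0 (e / 4))) as [N HN]; [apply Rmin_pos; lra|].
  pose proof (Rmin_l d0 (e / 4)). pose proof (Rmin_r d0 (e / 4)).
  exists N. intros n m u _ Hn Hm. simpl.
  assert (forall n m, (N <= n)%nat -> (N <= m)%nat ->
    approximating_sequence n (clamp u) - approximating_sequence m (clamp u) < e) as Hle.
  { clear n m Hn Hm. intros n m Hn Hm. pose proof (HN n Hn). pose proof (HN m Hm).
    pose proof (clamp_in u) as Hu.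
    assert (0 <= / (INR n + 1) + / (INR m + 1)) by lra.
    pose proof (Hclose (/ (INR n + 1)) (/ (INR m + 1)) _ _ ltac:(lra) ltac:(lra)
      (approximating_sequence_spec n) (approximating_sequence_spec m) (clamp u) Hu).
    assert ((/ (INR n + 1) + / (INR m + 1)) * (1 - clamp u) <= (/ (INR n + 1) + / (INR m + 1)) * 1).
    { apply Rmult_le_compat_l; lra. }
    lra. }
  pose proof (Hle n m Hn Hm). pose proof (Hle m n Hm Hn). apply Rabs_def1; lra.
Qed.

Lemma profile_near (e : R) : 0 < e -> exists N, forall n, (N <= n)%nat ->
  forall u, 0 <= u <= 1 -> Rabs (approximating_sequence n u - profile u) < e.
Proof.
  intros He. destruct (profile_uniform_limit (mkposreal e He)) as [N HN].
  exists N. intros n Hn u Hu. specialize (HN n Hn u I). simpl in HN.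
  unfold profile. rewrite clamp_id in * by assumption. exact HN.
Qed.

Lemma profile_continuous (u : R) : continuous profile u.
Proof.
  apply continuity_pt_filterlim.
  apply (CVU_cont_open _ (fun _ => True) open_true profile_uniform_limit); [|exact I].
  intros n x _. apply continuity_pt_filterlim.
  apply (continuous_comp clamp (approximating_sequence n)); [apply continuous_clamp|].
  destruct (approximating_sequence_spec n) as [V' [_ [HV _]]].
  exact (is_derive_continuous _ _ _ (HV _)).
Qed.

Lemma profile_positive (p : R) : 0 < p < 1 -> 0 < profile p.
Proof.
  intros Hp. destruct (truncated_approximation_positive p Hp) as [c [d0 [Hc [Hd0 H]]]].
  destruct (profile_near (c / 4)) as [N1 HN1]; [lra|].
  destruct (inv_INR_small (Rmin d0 (c / 4))) as [N2 HN2]; [apply Rmin_pos; lra|].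
  pose proof (Rmin_l d0 (c / 4)). pose proof (Rmin_r d0 (c / 4)).
  specialize (HN1 (Nat.max N1 N2) ltac:(lia) p ltac:(lra)).
  specialize (HN2 (Nat.max N1 N2) ltac:(lia)).
  specialize (H (/ (INR (Nat.max N1 N2) + 1)) _ ltac:(lra) (approximating_sequence_spec _)).
  apply Rabs_def2 in HN1. lra.
Qed.

Lemma le_of_approx (x b : R) : (forall e, 0 < e -> exists x', Rabs (x' - x) < e /\ x' <= b) -> x <= b.
Proof.
  intros H. apply Rnot_lt_le. intros Hlt. destruct (H (x - b)) as [x' [H1 H2]]; [lra|].
  apply Rabs_def2 in H1. lra.
Qed.

Lemma profile_derive (p : R) : 0 < p < 1 ->
  is_derive profile p (sigma - F p / G p (profile p)).
Proof.
  intros Hp. pose proof (profile_positive p Hp) as Hv. set (v := profile p) in *.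
  pose proof (G_pos F G HFG p v Hv) as HGp.
  apply is_derive_eps. intros e He.
  assert (continuity_2d_pt (fun u w => sigma - F u / G u w) p v) as Hcont.
  { apply continuity_2d_pt_minus; [apply continuity_2d_pt_const|]. apply continuity_2d_pt_mult.
    - apply (continuity_1d_2d_pt_comp F (fun u _ => u)); [|apply continuity_2d_pt_id1].
      apply continuity_pt_filterlim, (F_continuous F G HFG).
    - apply continuity_2d_pt_inv; [apply (G_continuous F G HFG)|lra]. }
  (* Half of [e] pays for the variation of the right-hand side near [(p, v)], half for the tolerance
     of the approximate equation. *)
  assert (0 < e / 2) as He2 by lra. assert (0 < G p v / 2) as HG2 by lra.
  destruct (Hcont (mkposreal _ He2)) as [r1 Hr1].
  destruct (G_continuous F G HFG p v (mkposreal _ HG2)) as [r2 Hr2]. simpl in Hr1, Hr2.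
  pose proof (cond_pos r1). pose proof (cond_pos r2).
  set (r := Rmin (Rmin r1 r2) (v / 2)).
  assert (0 < r /\ r <= r1 /\ r <= r2 /\ r <= v / 2) as Hr.
  { unfold r. pose proof (Rmin_l (Rmin r1 r2) (v / 2)). pose proof (Rmin_r (Rmin r1 r2) (v / 2)).
    pose proof (Rmin_l r1 r2). pose proof (Rmin_r r1 r2).
    assert (0 < Rmin (Rmin r1 r2) (v / 2)) by (repeat apply Rmin_pos; lra). lra. }
  destruct (proj1 (continuous_eps profile p) (profile_continuous p) (r / 2)) as [r3 [Hr3 Hprof]]; [lra|].
  set (rr := Rmin (Rmin r r3) (Rmin p (1 - p))).
  assert (0 < rr /\ rr <= r /\ rr <= r3 /\ rr <= p /\ rr <= 1 - p) as Hrr.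
  { unfold rr. pose proof (Rmin_l (Rmin r r3) (Rmin p (1 - p))).
    pose proof (Rmin_r (Rmin r r3) (Rmin p (1 - p))).
    pose proof (Rmin_l r r3). pose proof (Rmin_r r r3).
    pose proof (Rmin_l p (1 - p)). pose proof (Rmin_r p (1 - p)).
    assert (0 < Rmin (Rmin r r3) (Rmin p (1 - p))) by (repeat apply Rmin_pos; lra). lra. }
  destruct (profile_near (r / 2)) as [N1 HN1]; [lra|].
  destruct (inv_INR_small (Rmin (e / 2) (Rmin (G p v / 2) (v / 2)))) as [N2 HN2];
    [repeat apply Rmin_pos; lra|].
  pose proof (Rmin_l (e / 2) (Rmin (G p v / 2) (v / 2))).
  pose proof (Rmin_r (e / 2) (Rmin (G p v / 2) (v / 2))).
  pose proof (Rmin_l (G p v / 2) (v / 2)). pose proof (Rmin_r (G p v / 2) (v / 2)).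
  exists rr. split; [tauto|]. intros y Hy. fold v.
  set (l := sigma - F p / G p v) in *.
  (* Away from V = 0 the truncation is inactive, so the mean value theorem controls
     the difference quotients of all late approximations at once. *)
  assert (forall n, (N1 <= n)%nat -> (N2 <= n)%nat ->
    Rabs (approximating_sequence n y - approximating_sequence n p - l * (y - p))
      <= e * Rabs (y - p)) as Hn.
  { intros n Hn1 Hn2. specialize (HN1 n Hn1). specialize (HN2 n Hn2).
    destruct (approximating_sequence_spec n) as [V' [_ [HV HV']]].
    destruct (MVT_gen (approximating_sequence n) p y V') as [xi [Hxi E]].
    - intros; apply HV.
    - intros z _. apply continuity_pt_filterlim. exact (is_derive_continuous _ _ _ (HV _)).
    - rewrite E, <- Rmult_minus_distr_r, Rabs_mult.
      apply Rmult_le_compat_r; [apply Rabs_pos|].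
      assert (Rabs (xi - p) < rr) as Hxip.
      { apply Rabs_def2 in Hy. unfold Rmin, Rmax in Hxi; destruct Rle_dec; apply Rabs_def1; lra. }
      assert (Rabs (xi - p) < r3) as Hx3 by lra.
      apply Hprof in Hx3. fold v in Hx3.
      assert (0 <= xi <= 1) as Hxi01 by (apply Rabs_def2 in Hxip; lra).
      specialize (HN1 xi Hxi01).
      assert (Rabs (approximating_sequence n xi - v) < r) as Hw.
      { apply Rabs_def2 in HN1. apply Rabs_def2 in Hx3. apply Rabs_def1; lra. }
      specialize (Hr1 xi (approximating_sequence n xi) ltac:(lra) ltac:(lra)).
      specialize (Hr2 xi (approximating_sequence n xi) ltac:(lra) ltac:(lra)).
      apply Rabs_def2 in Hr2. apply Rabs_def2 in Hw.
      specialize (HV' xi Hxi01). rewrite truncated_rhs_eq in HV' by lra.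
      fold l in Hr1. apply Rabs_def2 in Hr1. apply Rabs_def2 in HV'. apply Rabs_le. lra. }
  assert (0 <= y <= 1) as Hy01 by (apply Rabs_def2 in Hy; lra).
  apply le_of_approx. intros e' He'.
  destruct (profile_near (e' / 2)) as [N3 HN3]; [lra|].
  set (n := Nat.max N1 (Nat.max N2 N3)).
  exists (Rabs (approximating_sequence n y - approximating_sequence n p - l * (y - p))).
  split; [|apply Hn; lia].
  pose proof (HN3 n ltac:(lia) y Hy01) as H1'. pose proof (HN3 n ltac:(lia) p ltac:(lra)) as H2'.
  fold v in H2'.
  eapply Rle_lt_trans; [apply Rabs_triang_inv2|].
  apply Rabs_def2 in H1'. apply Rabs_def2 in H2'. apply Rabs_def1; lra.
Qed.

Lemma profile_solution_exists : exists V, profile_solution F G sigma V.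
Proof.
  exists profile. split; [apply profile_continuous|]. split.
  - unfold profile. rewrite clamp_id by lra.
    rewrite (Lim_seq_ext _ (fun _ => 0)); [now rewrite Lim_seq_const|].
    intros n. now destruct (approximating_sequence_spec n) as [V' [H _]].
  - intros u Hu. split; [now apply profile_positive|now apply profile_derive].
Qed.

End ProfileExistence.

(** * The flux and its inverse *)

Section Flux.

Variables (w : R -> Rbar) (a : R -> R -> R) (f : R -> R).
Hypotheses (Hst : standing_assumptions w a f)
  (Ha_plus : forall u, I01 u -> a_plus w a u = p_infty).

Lemma Omega_iff (u s : R) : Omega w (u, s) <-> I01 u /\ Rbar_lt (Rabs s) (w u).
Proof.
  unfold Omega; simpl. destruct (w u) as [x| |]; simpl; split; intros H; try tauto.
  - split; [tauto|]. apply Rabs_def1; lra.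
  - destruct H as [H1 H2]. apply Rabs_def2 in H2. repeat split; try apply H1; lra.
Qed.

Lemma Omega_opp (u s : R) : Omega w (u, s) -> Omega w (u, - s).
Proof. now rewrite !Omega_iff, Rabs_Ropp. Qed.

Lemma Omega_convex (u s1 s s2 : R) :
  Omega w (u, s1) -> Omega w (u, s2) -> s1 <= s <= s2 -> Omega w (u, s).
Proof.
  unfold Omega; simpl; intros [H1 [H2 _]] [_ [_ H3]] Hs. split; [assumption|].
  destruct (w u); simpl in *; try tauto. lra.
Qed.

Lemma Omega_0 (u : R) : I01 u -> Omega w (u, 0).
Proof.
  intros Hu. rewrite Omega_iff, Rabs_R0. split; [assumption|]. now apply (omega_pos w a f Hst).
Qed.

(** Pick a real [c] strictly between |s| and omega_+(u): by lower semicontinuity [c] stays below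
    omega_+ nearby, and |s'| stays below [c]. *)
Lemma Omega_open (u s : R) : Omega w (u, s) -> exists d, 0 < d /\
  forall u' s', I01 u' -> Rabs (u' - u) < d -> Rabs (s' - s) < d -> Omega w (u', s').
Proof.
  rewrite Omega_iff. intros [Hu Hs].
  assert (exists c : R, Rabs s < c /\ Rbar_lt c (w u)) as [c [Hc1 Hc2]].
  { destruct (w u) as [x| |]; simpl in *.
    - exists ((Rabs s + x) / 2). lra.
    - exists (Rabs s + 1). split; [lra|exact I].
    - tauto. }
  destruct (omega_lsc w a f Hst u Hu c Hc2) as [d Hd].
  pose proof (cond_pos d).
  exists (Rmin d (c - Rabs s)). split; [apply Rmin_pos; lra|].
  intros u' s' Hu' H1 H2. rewrite Omega_iff. split; [assumption|].
  apply Rbar_lt_trans with c.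
  - simpl. pose proof (Rmin_r d (c - Rabs s)).
    pose proof (Rabs_triang_inv s' s). lra.
  - apply Hd; [|assumption]. apply Rlt_le_trans with (1 := H1), Rmin_l.
Qed.

Lemma continuous_on_Omega_eps (h : R * R -> R) (u s e : R) :
  continuous_on (Omega w) h -> Omega w (u, s) -> 0 < e ->
  exists d, 0 < d /\ forall u' s', I01 u' -> Rabs (u' - u) < d -> Rabs (s' - s) < d ->
    Omega w (u', s') /\ Rabs (h (u', s') - h (u, s)) < e.
Proof.
  intros Hh Hus He. destruct (Omega_open u s Hus) as [d1 [Hd1 HO]].
  destruct (proj1 (filterlim_locally _ _) (Hh _ Hus) (mkposreal e He)) as [d2 Hd2].
  pose proof (cond_pos d2). pose proof (Rmin_l d1 d2). pose proof (Rmin_r d1 d2).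
  exists (Rmin d1 d2). split; [now apply Rmin_pos|]. intros u' s' Hu' H1' H2'.
  assert (Omega w (u', s')) as HO' by (apply HO; auto; lra).
  split; [assumption|]. apply (Hd2 (u', s')); [|assumption].
  split; simpl; eapply Rlt_le_trans; eauto.
Qed.

Lemma flux_continuous_s (u s : R) : Omega w (u, s) -> continuous (a u) s.
Proof.
  intros Hus. apply continuous_eps. intros e He.
  destruct (continuous_on_Omega_eps _ u s e (flux_continuous w a f Hst) Hus He) as [d [Hd H]].
  exists d. split; [assumption|]. intros y Hy. apply (H u y); [apply Hus| |assumption].
  rewrite Rminus_diag, Rabs_R0. lra.
Qed.

Lemma flux_lt_inv (u s r : R) : Omega w (u, s) -> Omega w (u, r) -> a u s < a u r -> s < r.
Proof.
  intros Hs Hr H. destruct (Rtotal_order s r) as [|[->|Hlt]]; [assumption|lra|].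
  pose proof (flux_increasing w a f Hst u r s Hr Hs Hlt). lra.
Qed.

Lemma flux_0 (u : R) : I01 u -> a u 0 = 0.
Proof.
  intros Hu. pose proof (flux_odd w a f Hst u 0 (Omega_0 u Hu)) as H. rewrite Ropp_0 in H. lra.
Qed.

(* The [epsilon] defining [a_plus] is taken over a nonempty set: the limit is the
   supremum of the flux. *)
Lemma a_plus_spec (u : R) : I01 u ->
  filterlim (fun s => a u s)
    (within (fun s => Omega w (u, s)) (Rbar_locally' (w u)))
    (Rbar_locally (a_plus w a u)).
Proof.
  intros Hu. unfold a_plus. apply epsilon_spec.
  assert (forall s0 (P : R -> Prop), Omega w (u, s0) ->
    (forall s, Omega w (u, s) -> s0 < s -> P (a u s)) ->
    within (fun s => Omega w (u, s)) (Rbar_locally' (w u)) (fun s => P (a u s))) as Hev.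
  { intros s0 P Hs0 HP. unfold within. unfold Omega in Hs0; simpl in Hs0.
    destruct (w u) as [x| |] eqn:E; simpl in *; [|exists s0; auto|tauto].
    assert (0 < x - s0) as Hx by lra.
    exists (mkposreal _ Hx). intros y Hy _ HO. apply HP; [assumption|].
    apply Rabs_def2 in Hy. unfold minus, plus, opp in Hy; simpl in Hy. lra. }
  set (A := fun y => exists s, Omega w (u, s) /\ y = a u s).
  destruct (Lub_Rbar_correct A) as [Hub Hlub].
  exists (Lub_Rbar A). destruct (Lub_Rbar A) as [l| |].
  - intros P [d HP].
    assert (exists s, Omega w (u, s) /\ l - d < a u s) as [s0 [Hs0 Hlt]].
    { apply NNPP. intros Hn. pose proof (cond_pos d).
      assert (Rbar_le l (l - d)) as Hle; [|simpl in Hle; lra].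
      apply Hlub. intros y [s [Hs ->]]. simpl. apply Rnot_lt_le. intros Hlt. apply Hn. now exists s. }
    apply (Hev s0 P Hs0). intros s Hs Hss. apply HP.
    assert (Rbar_le (a u s) l) as Hle by (apply Hub; now exists s). simpl in Hle.
    pose proof (flux_increasing w a f Hst u s0 s Hs0 Hs Hss).
    change (Rabs (a u s - l) < d). apply Rabs_def1; lra.
  - intros P [M HP].
    assert (exists s, Omega w (u, s) /\ M < a u s) as [s0 [Hs0 Hlt]].
    { apply NNPP. intros Hn.
      assert (Rbar_le p_infty M) as Hle; [|exact Hle].
      apply Hlub. intros y [s [Hs ->]]. simpl. apply Rnot_lt_le. intros Hlt. apply Hn. now exists s. }
    apply (Hev s0 P Hs0). intros s Hs Hss. apply HP.
    pose proof (flux_increasing w a f Hst u s0 s Hs0 Hs Hss). lra.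
  - exfalso. assert (Rbar_le (a u 0) m_infty) as Hle; [|exact Hle].
    apply Hub. exists 0. split; [now apply Omega_0|reflexivity].
Qed.

Lemma flux_unbounded (u M : R) : I01 u -> exists s, Omega w (u, s) /\ M < a u s.
Proof.
  intros Hu. pose proof (a_plus_spec u Hu) as Hlim. rewrite (Ha_plus u Hu) in Hlim.
  assert (within (fun s => Omega w (u, s)) (Rbar_locally' (w u)) (fun s => M < a u s)) as H.
  { apply (Hlim (fun y => M < y)). now exists M. }
  unfold within in H. pose proof (omega_pos w a f Hst u Hu) as Hpos.
  assert (exists s, Omega w (u, s) /\ (Omega w (u, s) -> M < a u s)) as [s [H1 H2]];
    [|exists s; auto].
  setoid_rewrite (Omega_iff u) at 1.
  destruct (w u) as [x| |]; simpl in *; [|destruct H as [N HN]|tauto].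
  - destruct H as [d Hd]. pose proof (cond_pos d).
    pose proof (Rmin_l d x). pose proof (Rmin_r d x).
    assert (0 < Rmin d x) by now apply Rmin_pos.
    (* The limit statement concerns points of [Omega] only, so a witness must be both within [d] of
       [x] and inside (0, x). *)
    exists (x - Rmin d x / 2). split; [split; [assumption|apply Rabs_def1; lra]|].
    apply Hd; [|lra]. change (Rabs (x - Rmin d x / 2 - x) < d). apply Rabs_def1; lra.
  - exists (N + 1). split; [split; [assumption|exact I]|]. apply HN. lra.
Qed.

(** By oddness, one point where the flux exceeds |v| gives a symmetric bracket for the intermediate
    value theorem. Thus [g] is meaningful on all of [0,1] x R. *)
Lemma flux_surjective (u v : R) : I01 u -> exists s, Omega w (u, s) /\ a u s = v.
Proof.
  intros Hu. destruct (flux_unbounded u (Rabs v) Hu) as [s1 [Hs1 Hlt]].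
  pose proof (Omega_opp u s1 Hs1) as Hs2. pose proof (flux_odd w a f Hst u s1 Hs1) as Hodd.
  pose proof (Rle_abs v). pose proof (Rle_abs (- v)) as Hv'. rewrite Rabs_Ropp in Hv'.
  pose proof (flux_lt_inv u (- s1) s1 Hs2 Hs1 ltac:(lra)).
  destruct (Ranalysis5.IVT_interv (fun s => a u s - v) (- s1) s1) as [s [Hs E]]; try lra.
  - intros s Hs. apply continuity_pt_filterlim.
    apply (continuous_minus (V := R_NormedModule)); [|apply continuous_const].
    apply flux_continuous_s. now apply Omega_convex with (- s1) s1.
  - exists s. split; [now apply Omega_convex with (- s1) s1|lra].
Qed.

Lemma g_spec (u v : R) : I01 u -> Omega w (u, g w a u v) /\ a u (g w a u v) = v.
Proof. intros Hu. unfold g. apply epsilon_spec. now apply flux_surjective. Qed.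

Lemma g_unique (u s : R) : Omega w (u, s) -> g w a u (a u s) = s.
Proof.
  intros Hs. destruct (g_spec u (a u s) (proj1 Hs)) as [H1 H2].
  destruct (Rtotal_order (g w a u (a u s)) s) as [H|[H|H]]; [|assumption|];
    apply (flux_increasing w a f Hst u) in H; auto; lra.
Qed.

Definition reaction_clamped (u : R) : R := f (clamp u).
Definition g_clamped (u v : R) : R := g w a (clamp u) v.

Lemma clamp_lipschitz (u v : R) : Rabs (clamp u - clamp v) <= Rabs (u - v).
Proof.
  unfold clamp, Rmax, Rmin; unfold Rabs; repeat destruct Rle_dec; repeat destruct Rcase_abs; lra.
Qed.

(** Monotone sandwich: the flux at [s - h] and [s + h] lies strictly on either side of [v], and
    continuity of [a] preserves this for nearby [(u', v')], which traps the new root between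
    them. *)
Lemma g_clamped_continuous (u v : R) : continuity_2d_pt g_clamped u v.
Proof.
  intros e. unfold g_clamped.
  pose proof (clamp_in u) as Hu. set (c := clamp u) in *.
  destruct (g_spec c v Hu) as [Hs Ha]. set (s := g w a c v) in *.
  destruct (Omega_open c s Hs) as [d [Hd HO]].
  pose proof (cond_pos e).
  set (h := Rmin (d / 2) (e / 2)).
  assert (0 < h /\ h < d /\ h < e) as Hh.
  { unfold h. pose proof (Rmin_l (d / 2) (e / 2)). pose proof (Rmin_r (d / 2) (e / 2)).
    assert (0 < Rmin (d / 2) (e / 2)) by (apply Rmin_pos; lra). lra. }
  assert (Rabs (c - c) < d) as Hcc by (rewrite Rminus_diag, Rabs_R0; lra).
  assert (Omega w (c, s - h)) as Hm by (apply HO; auto; apply Rabs_def1; lra).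
  assert (Omega w (c, s + h)) as Hp by (apply HO; auto; apply Rabs_def1; lra).
  pose proof (flux_increasing w a f Hst c _ _ Hm Hs ltac:(lra)) as H1.
  pose proof (flux_increasing w a f Hst c _ _ Hs Hp ltac:(lra)) as H2.
  rewrite Ha in H1, H2.
  (* Half of each gap, because both the flux and [v'] may move by up to [k]. *)
  set (k := Rmin ((v - a c (s - h)) / 2) ((a c (s + h) - v) / 2)).
  assert (0 < k /\ k <= (v - a c (s - h)) / 2 /\ k <= (a c (s + h) - v) / 2) as Hk.
  { unfold k. split; [apply Rmin_pos; lra|]. split; [apply Rmin_l|apply Rmin_r]. }
  destruct (continuous_on_Omega_eps _ c (s - h) k (flux_continuous w a f Hst) Hm (proj1 Hk))
    as [dm [Hdm Hcm]].
  destruct (continuous_on_Omega_eps _ c (s + h) k (flux_continuous w a f Hst) Hp (proj1 Hk))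
    as [dp [Hdp Hcp]].
  assert (0 < Rmin k (Rmin dm dp)) as Hr by (repeat apply Rmin_pos; lra).
  pose proof (Rmin_l k (Rmin dm dp)). pose proof (Rmin_r k (Rmin dm dp)).
  pose proof (Rmin_l dm dp). pose proof (Rmin_r dm dp).
  exists (mkposreal _ Hr). simpl. intros u' v' Hu' Hv'.
  pose proof (clamp_in u') as Hc'. pose proof (clamp_lipschitz u' u) as HL.
  fold c in HL. set (c' := clamp u') in *.
  destruct (Hcm c' (s - h) Hc' ltac:(lra)) as [HOm Ham]; [rewrite Rminus_diag, Rabs_R0; lra|].
  destruct (Hcp c' (s + h) Hc' ltac:(lra)) as [HOp Hap]; [rewrite Rminus_diag, Rabs_R0; lra|].
  simpl in Ham, Hap. apply Rabs_def2 in Ham. apply Rabs_def2 in Hap. apply Rabs_def2 in Hv'.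
  destruct (g_spec c' v' Hc') as [Hs' Ha'].
  assert (s - h < g w a c' v') by (apply (flux_lt_inv c'); auto; lra).
  assert (g w a c' v' < s + h) by (apply (flux_lt_inv c'); auto; lra).
  apply Rabs_def1; lra.
Qed.

(** Gives the continuity of [f] and, at its zeros 0 and 1, the linear bounds f(u) = O(u) and f(u) =
    O(1 - u). *)
Lemma reaction_local_lipschitz (u : R) : I01 u -> exists K d, 0 < K /\ 0 < d /\
  forall y, I01 y -> Rabs (y - u) < d -> Rabs (f y - f u) <= K * Rabs (y - u).
Proof.
  intros Hu. destruct (reaction_C1 w a f Hst) as [f' [Hf' _]].
  destruct (proj1 (filterlim_locally _ _) (Hf' u Hu) (mkposreal 1 Rlt_0_1)) as [d Hd].
  exists (Rabs (f' u) + 1), d. pose proof (Rabs_pos (f' u)).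
  split; [lra|]. split; [apply cond_pos|]. intros y Hy Hyd.
  destruct (Req_dec y u) as [->|Hne]; [rewrite !Rminus_diag, Rabs_R0; lra|].
  specialize (Hd y Hyd Hne Hy). change (Rabs ((f y - f u) / (y - u) - f' u) < 1) in Hd.
  replace (f y - f u) with ((f y - f u) / (y - u) * (y - u)) by (field; lra).
  rewrite Rabs_mult. apply Rmult_le_compat_r; [apply Rabs_pos|].
  pose proof (Rabs_triang_inv ((f y - f u) / (y - u)) (f' u)). lra.
Qed.

Lemma reaction_clamped_continuous (u : R) : continuous reaction_clamped u.
Proof.
  apply continuous_eps. intros e He. unfold reaction_clamped.
  destruct (reaction_local_lipschitz (clamp u) (clamp_in u)) as [K [d [HK [Hd H]]]].
  exists (Rmin d (e / K)). split; [apply Rmin_pos; [assumption|now apply Rdiv_lt_0_compat]|].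
  intros y Hy. pose proof (Rmin_l d (e / K)). pose proof (Rmin_r d (e / K)).
  pose proof (clamp_lipschitz y u).
  apply Rle_lt_trans with (K * Rabs (clamp y - clamp u)).
  - apply H; [apply clamp_in|lra].
  - apply Rlt_le_trans with (K * (e / K)); [|right; field; lra].
    apply Rmult_lt_compat_l; lra.
Qed.

Lemma reaction_nonneg (u : R) : I01 u -> 0 <= f u.
Proof.
  intros [H0 H1]. destruct H0 as [H0|H0].
  - destruct H1 as [H1|H1].
    + left. now apply (reaction_pos w a f Hst).
    + rewrite H1, (reaction_1 w a f Hst). apply Rle_refl.
  - rewrite <- H0, (reaction_0 w a f Hst). apply Rle_refl.
Qed.

Lemma clamped_regular_data : regular_data reaction_clamped g_clamped.
Proof.
  split.
  - exact reaction_clamped_continuous.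
  - intros u. apply reaction_nonneg, clamp_in.
  - destruct (continuity_ab_maj reaction_clamped 0 1) as [m [Hm _]]; [lra| |].
    + intros c _. apply continuity_pt_filterlim, reaction_clamped_continuous.
    + exists (reaction_clamped m). intros u. specialize (Hm (clamp u) (clamp_in u)).
      unfold reaction_clamped at 1 in Hm. now rewrite (clamp_id (clamp u) (clamp_in u)) in Hm.
  - intros u Hu. unfold reaction_clamped. rewrite clamp_id by lra.
    now apply (reaction_pos w a f Hst).
  - exact g_clamped_continuous.
  - intros u v1 v2 Hv. unfold g_clamped. pose proof (clamp_in u) as Hu.
    destruct (g_spec _ v1 Hu). destruct (g_spec _ v2 Hu).
    apply (flux_lt_inv (clamp u)); auto. lra.
  - intros u. unfold g_clamped. pose proof (clamp_in u) as Hu.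
    rewrite <- (flux_0 _ Hu) at 1. apply g_unique. now apply Omega_0.
Qed.

End Flux.

(** * Dependence on the speed *)

Lemma filterlim_Rminus (Fl : (R -> Prop) -> Prop) {HF : Filter Fl} (h k : R -> R) (x y : R) :
  filterlim h Fl (locally x) -> filterlim k Fl (locally y) ->
  filterlim (fun u => h u - k u) Fl (locally (x - y)).
Proof.
  intros Hh Hk.
  assert (filterlim (fun u => - k u) Fl (locally (- y))) as Hk'.
  { eapply filterlim_comp; [exact Hk|]. exact (filterlim_opp (V := R_NormedModule) y). }
  apply (filterlim_comp_2 h (fun u => - k u) Rplus Hh Hk').
  exact (filterlim_plus (V := R_NormedModule) x (- y)).
Qed.

Section Ordering.

Variables (F : R -> R) (G : R -> R -> R).
Hypothesis HFG : regular_data F G.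

Lemma F_div_G_le (u v1 v2 : R) : 0 < v1 <= v2 -> F u / G u v2 <= F u / G u v1.
Proof.
  intros Hv. apply (F_div_le F G HFG). split; [now apply (G_pos F G HFG)|now apply (G_le F G HFG)].
Qed.

Section TwoSpeeds.

Variables (sigma tau p : R) (V W : R -> R).
Hypotheses (Hle : sigma <= tau) (Hp : p < 1)
  (HV : forall u, p <= u < 1 -> 0 < V u /\ is_derive V u (sigma - F u / G u (V u)))
  (HW : forall u, p <= u < 1 -> 0 < W u /\ is_derive W u (tau - F u / G u (W u)))
  (HV1 : filterlim V (at_left 1) (locally 0))
  (HW1 : filterlim W (at_left 1) (locally 0)).

(** Where [W > V], the larger speed and the smaller quotient both push [W - V] upwards as [u] grows,
    so it could not tend to 0 at [u = 1]. Equal speeds are allowed, and then the lemma used twice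
    gives uniqueness. *)
Lemma solution_decreasing_in_speed : W p <= V p.
Proof.
  assert (W p - V p <= 0); [|lra].
  apply (comparison (fun u => W u - V u)
    (fun u => (tau - F u / G u (W u)) - (sigma - F u / G u (V u))) p 1 (0 - 0)); [assumption| | | |lra].
  - intros u Hu. apply (is_derive_minus (V := R_NormedModule)); [now apply HW|now apply HV].
  - intros u Hu Hpos. destruct (HV u Hu) as [HVu _].
    pose proof (F_div_G_le u (V u) (W u)). lra.
  - now apply filterlim_Rminus; [apply within_filter, locally_filter| |].
Qed.

(** Where [V > W] the quotients help; the slope of the subtracted linear term pays exactly for the
    difference of the speeds. *)
Lemma solution_lipschitz_in_speed : V p <= W p + (tau - sigma) * (1 - p).
Proof.
  assert (V p - W p - (tau - sigma) * (1 - p) <= 0); [|lra].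
  apply (comparison (fun u => V u - W u - (tau - sigma) * (1 - u))
    (fun u => (sigma - F u / G u (V u)) - (tau - F u / G u (W u)) - - (tau - sigma)) p 1 ((0 - 0) - (tau - sigma) * (1 - 1)));
    [assumption| | | |lra].
  - intros u Hu. apply (is_derive_minus (V := R_NormedModule)).
    + apply (is_derive_minus (V := R_NormedModule)); [now apply HV|now apply HW].
    + auto_derive; [exact I|ring].
  - intros u Hu Hpos. destruct (HW u Hu) as [HWu _].
    assert (0 <= (tau - sigma) * (1 - u)) by (apply Rmult_le_pos; lra).
    pose proof (F_div_G_le u (W u) (V u)). lra.
  - apply (filterlim_Rminus (at_left 1) (fun u => V u - W u)).
    + now apply filterlim_Rminus; [apply within_filter, locally_filter| |].
    + apply (continuous_at_left (fun u => (tau - sigma) * (1 - u))).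
      apply (ex_derive_continuous (fun u => (tau - sigma) * (1 - u))). auto_derive. exact I.
Qed.

End TwoSpeeds.

Lemma profile_solution_at_left (sigma : R) (V : R -> R) :
  profile_solution F G sigma V -> filterlim V (at_left 1) (locally 0).
Proof.
  intros [Hc [H1 _]]. rewrite <- H1. now apply continuous_at_left.
Qed.

(** The equation holds only on (0,1), so comparisons are made there and carried to 0 by
    continuity. *)
Lemma continuous_nonpos_0 (h : R -> R) :
  continuous h 0 -> (forall p, 0 < p < 1 -> h p <= 0) -> h 0 <= 0.
Proof.
  intros Hc Hh. apply Rnot_lt_le. intros Hlt.
  destruct (proj1 (continuous_eps h 0) Hc (h 0) Hlt) as [d [Hd H]].
  pose proof (Rmin_l d 1). pose proof (Rmin_r d 1).
  assert (0 < Rmin d 1) by (apply Rmin_pos; lra).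
  specialize (H (Rmin d 1 / 2)). assert (Rabs (Rmin d 1 / 2 - 0) < d) as Habs by (apply Rabs_def1; lra).
  apply H, Rabs_def2 in Habs. specialize (Hh (Rmin d 1 / 2)). lra.
Qed.

Lemma profile_solution_0_nonneg (sigma : R) (V : R -> R) :
  profile_solution F G sigma V -> 0 <= V 0.
Proof.
  intros [Hc [_ HV]]. assert (- V 0 <= 0); [|lra].
  apply (continuous_nonpos_0 (fun u => - V u)).
  - apply (continuous_opp (V := R_NormedModule)), Hc.
  - intros p Hp. destruct (HV p Hp). lra.
Qed.

Lemma profile_solution_on (sigma : R) (V : R -> R) (p : R) :
  profile_solution F G sigma V -> 0 < p ->
  forall u, p <= u < 1 -> 0 < V u /\ is_derive V u (sigma - F u / G u (V u)).
Proof. intros [_ [_ HV]] Hp u Hu. apply HV. lra. Qed.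

(** Common reformulation of the sets behind [sigma_s] and, for positive speeds, [sigma_r]; existence
    of a wave is reduced to it as well. *)
Definition vanishing_speed (sigma : R) : Prop :=
  0 <= sigma /\ exists V, profile_solution F G sigma V /\ V 0 = 0.

Lemma vanishing_speed_le (sigma tau : R) :
  vanishing_speed sigma -> sigma <= tau -> vanishing_speed tau.
Proof.
  intros [Hs [V [HV HV0]]] Hle. split; [lra|].
  destruct (profile_solution_exists F G tau HFG) as [W HW]; [lra|].
  exists W. split; [assumption|].
  pose proof (profile_solution_0_nonneg tau W HW).
  assert (W 0 - V 0 <= 0); [|lra].
  apply (continuous_nonpos_0 (fun u => W u - V u)).
  - apply (continuous_minus (V := R_NormedModule)); [apply HW|apply HV].
  - intros p Hp. assert (W p <= V p); [|lra].
    apply solution_decreasing_in_speed with sigma tau; auto; try lra.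
    + now apply profile_solution_on.
    + now apply profile_solution_on.
    + now apply profile_solution_at_left with sigma.
    + now apply profile_solution_at_left with tau.
Qed.

(** Lipschitz dependence bounds V(0) at speed [sigma] by its value 0 at speed [sigma + e], plus [e],
    for every positive [e]. *)
Lemma vanishing_speed_closed (sigma : R) : 0 <= sigma ->
  (forall tau, sigma < tau -> vanishing_speed tau) -> vanishing_speed sigma.
Proof.
  intros Hs Htau. split; [assumption|].
  destruct (profile_solution_exists F G sigma HFG Hs) as [V HV].
  exists V. split; [assumption|].
  pose proof (profile_solution_0_nonneg sigma V HV).
  assert (V 0 <= 0); [|lra].
  apply le_epsilon. intros e He. rewrite Rplus_0_l.
  destruct (Htau (sigma + e)) as [_ [W [HW HW0]]]; [lra|].
  assert (V 0 - W 0 - e * (1 - 0) <= 0); [|lra].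
  apply (continuous_nonpos_0 (fun u => V u - W u - e * (1 - u))).
  - apply (continuous_minus (V := R_NormedModule)).
    + apply (continuous_minus (V := R_NormedModule)); [apply HV|apply HW].
    + apply (ex_derive_continuous (fun u => e * (1 - u))). auto_derive. exact I.
  - intros p Hp. assert (V p <= W p + (sigma + e - sigma) * (1 - p)); [|lra].
    apply solution_lipschitz_in_speed; auto; try lra.
    + now apply profile_solution_on.
    + now apply profile_solution_on.
    + now apply profile_solution_at_left with sigma.
    + now apply profile_solution_at_left with (sigma + e).
Qed.

(* [u] is a supersolution of the equation as soon as sigma exceeds F(u)/G(u,u) + 1. *)
Lemma vanishing_speed_nonempty (B : R) : 0 <= B ->
  (forall u, 0 < u < 1 -> F u / G u u <= B) -> vanishing_speed (B + 1).
Proof.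
  intros HB0 HB. split; [lra|].
  destruct (profile_solution_exists F G (B + 1) HFG) as [V HV]; [lra|].
  exists V. split; [assumption|].
  pose proof (profile_solution_0_nonneg _ V HV). destruct HV as [Hc [HV1 HV]].
  assert (V 0 - 0 <= 0); [|lra].
  assert (forall u, continuous (fun u => V u - u) u) as Hc'.
  { intros u. apply (continuous_minus (V := R_NormedModule)); [apply Hc|apply continuous_id]. }
  apply (continuous_nonpos_0 (fun u => V u - u)); [apply Hc'|].
  intros p Hp.
  apply (comparison_continuous (fun u => V u - u) (fun u => B + 1 - F u / G u (V u) - 1) p 1);
    [lra| | |apply Hc'|lra].
  - intros u Hu. apply (is_derive_minus (V := R_NormedModule)); [apply HV; lra|].
    auto_derive; [exact I|ring].
  - intros u Hu Hpos. pose proof (F_div_G_le u u (V u)). specialize (HB u). lra.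
Qed.

Lemma minimal_speed_exists (B : R) : 0 <= B ->
  (forall u, 0 < u < 1 -> F u / G u u <= B) ->
  exists m, 0 <= m /\ forall sigma, vanishing_speed sigma <-> m <= sigma.
Proof.
  intros HB0 HB. pose proof (vanishing_speed_nonempty B HB0 HB) as Hne.
  (* [completeness] provides suprema, so the infimum of the speeds is taken through their
     negatives. *)
  destruct (completeness (fun x => vanishing_speed (- x))) as [M [HM1 HM2]].
  - exists 0. intros x [Hx _]. lra.
  - exists (- (B + 1)). now rewrite Ropp_involutive.
  - assert (0 <= - M) as HM.
    { assert (M <= 0); [|lra]. apply HM2. intros x [Hx _]. lra. }
    exists (- M). split; [assumption|].
    assert (vanishing_speed (- M)) as Hmin.
    { apply vanishing_speed_closed; [assumption|]. intros tau Htau.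
      apply NNPP. intros Hn.
      assert (M <= - tau); [|lra]. apply HM2. intros x Hx.
      apply Rnot_lt_le. intros Hlt. apply Hn. apply vanishing_speed_le with (- x); [assumption|lra]. }
    intros sigma. split; [|now apply vanishing_speed_le].
    intros Hs. rewrite <- (Ropp_involutive sigma) in Hs. specialize (HM1 _ Hs). lra.
Qed.

End Ordering.

(** * The functions V_sigma and the minimal speed *)

Lemma filterlim_within_local (D E : R -> Prop) (h k : R -> R) (x : R) (L : (R -> Prop) -> Prop) :
  locally x (fun y => E y -> D y /\ h y = k y) ->
  filterlim h (within D (locally x)) L -> filterlim k (within E (locally x)) L.
Proof.
  intros Hloc Hh P HP. specialize (Hh P HP). unfold filtermap, within in *.
  generalize (filter_and _ _ Hloc Hh). apply filter_imp.
  intros y [H1 H2] Hy. destruct (H1 Hy) as [H3 <-]. auto.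
Qed.

Lemma locally_between (lo hi u : R) : lo < u < hi -> locally u (fun x => lo < x < hi).
Proof.
  intros Hu. assert (0 < Rmin (u - lo) (hi - u)) as Hr by (apply Rmin_pos; lra).
  exists (mkposreal _ Hr). intros y Hy. change (Rabs (y - u) < Rmin (u - lo) (hi - u)) in Hy.
  pose proof (Rmin_l (u - lo) (hi - u)). pose proof (Rmin_r (u - lo) (hi - u)).
  apply Rabs_def2 in Hy. lra.
Qed.

Lemma filterlim_within_of_continuous (D : R -> Prop) (h : R -> R) (x : R) :
  continuous h x -> filterlim h (within D (locally x)) (locally (h x)).
Proof.
  intros H P HP. apply filter_le_within. now apply H.
Qed.

Section Speeds.

Variables (w : R -> Rbar) (a : R -> R -> R) (f : R -> R).
Hypotheses (Hst : standing_assumptions w a f)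
  (HaC1 : C1_Omega w a)
  (Ha_s : forall u s, Omega w (u, s) -> 0 < Derive (fun r => a u r) s)
  (Ha_plus : forall u, I01 u -> a_plus w a u = p_infty).

Let F := reaction_clamped f.
Let G := g_clamped w a.

Let HFG : regular_data F G := clamped_regular_data w a f Hst Ha_plus.

Lemma clamped_ratio (u v : R) : I01 u -> F u / G u v = f u / g w a u v.
Proof. intros Hu. unfold F, G, reaction_clamped, g_clamped. now rewrite clamp_id by exact Hu. Qed.

Lemma solution_Derive_continuous (sigma u : R) (V : R -> R) :
  0 < V u ->
  locally u (fun x => is_derive V x (sigma - F x / G x (V x))) ->
  continuous (Derive V) u.
Proof.
  intros Hpos Hloc.
  apply continuous_ext_loc with (fun x => sigma - F x / G x (V x)).
  - apply filter_imp with (2 := Hloc). intros x Hx. symmetry. now apply is_derive_unique.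
  - apply (continuous_minus (V := R_NormedModule)); [apply continuous_const|].
    apply (continuous_mult (K := R_AbsRing) F (fun x => / G x (V x))).
    + apply (F_continuous F G HFG).
    + apply (continuous_comp (fun x => G x (V x)) Rinv).
      * apply continuous_comp_2d; [apply (G_continuous F G HFG)|apply continuous_id|].
        exact (is_derive_continuous _ _ _ (locally_singleton _ _ Hloc)).
      * apply continuity_pt_filterlim, continuity_pt_inv; [apply continuity_pt_id|].
        pose proof (G_pos F G HFG u (V u) Hpos). unfold id. lra.
Qed.

Lemma profile_solution_C1 (sigma : R) (V : R -> R) :
  profile_solution F G sigma V -> C1_open 0 1 V.
Proof.
  intros [_ [_ HV]] u Hu. split; [exists (sigma - F u / G u (V u)); now apply HV|].
  apply (solution_Derive_continuous sigma); [now apply HV|].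
  apply filter_imp with (2 := locally_between 0 1 u Hu). intros x Hx. now apply HV.
Qed.

Lemma continuous_on_of_continuous (D : R -> Prop) (V : R -> R) :
  (forall u, continuous V u) -> continuous_on D V.
Proof. intros H. apply continuous_on_forall. intros u _. apply H. Qed.

Lemma profile_V_solution (sigma : R) (V : R -> R) :
  profile_solution F G sigma V -> V_solution w a f sigma 0 V.
Proof.
  intros HV. split; [|split; [|split]].
  - apply continuous_on_of_continuous, HV.
  - now apply profile_solution_C1 with sigma.
  - apply HV.
  - intros u Hu. destruct HV as [_ [_ HV]]. destruct (HV u Hu) as [H1 H2].
    assert (I01 u) as HI by (unfold I01; lra).
    split; [assumption|]. split; [now rewrite Ha_plus|].
    rewrite <- clamped_ratio by assumption. now apply is_derive_unique.
Qed.

Lemma calH_eq (u v : R) : I01 u -> calH w a u v = / g w a u v.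
Proof.
  intros Hu. unfold calH. destruct (Rbar_lt_dec v (a_plus w a u)) as [|H]; [reflexivity|].
  exfalso. apply H. now rewrite Ha_plus.
Qed.

Lemma calV_solution_V_solution (sigma : R) (V : R -> R) :
  calV_solution w a f sigma V -> V_solution w a f sigma 0 V.
Proof.
  intros [Hc [HC1 [Hd H1]]]. split; [|split; [|split]]; try assumption.
  - apply continuous_on_subset with I01; [|assumption]. unfold I01; intros; lra.
  - intros u Hu. assert (I01 u) as HI by (unfold I01; lra). destruct (Hd u Hu) as [Hpos HD].
    split; [assumption|]. split; [now rewrite Ha_plus|]. rewrite HD, calH_eq by assumption.
    reflexivity.
Qed.

Lemma profile_calV_solution (sigma : R) (V : R -> R) :
  profile_solution F G sigma V -> calV_solution w a f sigma V.
Proof.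
  intros HV. destruct (profile_V_solution sigma V HV) as [_ [HC1 [H1 Hd]]].
  split; [apply continuous_on_of_continuous, HV|]. split; [assumption|]. split; [|assumption].
  intros u Hu. assert (I01 u) as HI by (unfold I01; lra).
  destruct (Hd u Hu) as [Hpos [_ HD]]. split; [assumption|]. rewrite calH_eq by assumption. exact HD.
Qed.

(** Comparison at equal speeds, in both directions. As the reference solution lives on all of (0,1],
    every solution is a restriction of it, which gives maximality with [alpha = 0]. *)
Lemma V_solution_unique (sigma beta : R) (V W : R -> R) :
  profile_solution F G sigma V -> 0 <= beta < 1 -> V_solution w a f sigma beta W ->
  forall u, beta < u <= 1 -> W u = V u.
Proof.
  intros HV Hbeta [Hc [HC1 [HW1 HW]]] p Hp.
  destruct (Req_dec p 1) as [->|Hp1]; [rewrite HW1; symmetry; apply HV|].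
  assert (filterlim W (at_left 1) (locally 0)) as HWlim.
  { rewrite <- HW1. apply (filterlim_within_local (fun u => beta < u <= 1) _ W).
    - generalize (locally_between beta 2 1 ltac:(lra)). apply filter_imp.
      intros x Hx H. split; [lra|reflexivity].
    - apply (Hc 1). lra. }
  assert (forall u, p <= u < 1 -> 0 < W u /\ is_derive W u (sigma - F u / G u (W u))) as HW'.
  { intros u Hu. destruct (HW u ltac:(lra)) as [Hpos [_ HD]]. split; [assumption|].
    rewrite clamped_ratio by (unfold I01; lra). rewrite <- HD.
    apply Derive_correct, HC1. lra. }
  assert (0 < p) as Hp0 by lra.
  pose proof (profile_solution_on F G sigma V p HV Hp0) as HV'.
  pose proof (profile_solution_at_left F G sigma V HV) as HVlim.
  apply Rle_antisym; apply (solution_decreasing_in_speed F G HFG sigma sigma); auto; lra.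
Qed.

Lemma profile_is_alpha_V (sigma : R) (V : R -> R) :
  profile_solution F G sigma V -> is_alpha_V w a f sigma 0 V.
Proof.
  intros HV. split; [lra|]. split; [now apply profile_V_solution|].
  intros beta W Hbeta HW. split; [lra|]. now apply V_solution_unique with sigma.
Qed.

Lemma profile_is_calV (sigma : R) (V : R -> R) :
  profile_solution F G sigma V -> is_calV w a f sigma V.
Proof.
  intros HV. split; [now apply profile_calV_solution|]. intros W HW u Hu.
  assert (forall u, 0 < u <= 1 -> W u = V u) as Heq.
  { apply (V_solution_unique sigma 0); [assumption|lra|now apply calV_solution_V_solution]. }
  destruct Hu as [[Hu|<-] Hu1]; [apply Heq; lra|].
  (* At 0 the equation says nothing; the values agree as right limits of functions that coincide on
     (0,1]. *)
  apply (filterlim_locally_unique (F := at_right 0) W).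
  - apply (filterlim_within_local I01 _ W).
    + generalize (locally_between (-1) 1 0 ltac:(lra)). apply filter_imp.
      intros x Hx H. split; [unfold I01; lra|reflexivity].
    + apply (proj1 HW 0). unfold I01; lra.
  - apply (filterlim_within_local (fun _ => True) _ V).
    + generalize (locally_between (-1) 1 0 ltac:(lra)). apply filter_imp.
      intros x Hx H. split; [exact I|]. symmetry. apply Heq. lra.
    + apply filterlim_within_of_continuous, HV.
Qed.

Lemma is_alpha_0 (sigma : R) : 0 <= sigma -> is_alpha w a f sigma 0.
Proof.
  intros Hs. destruct (profile_solution_exists F G sigma HFG Hs) as [V HV].
  exists V. now apply profile_is_alpha_V.
Qed.

Lemma vanishing_speed_calV (sigma : R) :
  (0 <= sigma /\ exists V, is_calV w a f sigma V /\ V 0 = 0) <-> vanishing_speed F G sigma.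
Proof.
  split.
  - intros [Hs [W [[HW _] HW0]]]. split; [assumption|].
    destruct (profile_solution_exists F G sigma HFG Hs) as [V HV]. exists V. split; [assumption|].
    transitivity (W 0); [symmetry|exact HW0]. apply (proj2 (profile_is_calV sigma V HV)); [assumption|].
    unfold I01; lra.
  - intros [Hs [V [HV HV0]]]. split; [assumption|]. exists V. split; [|assumption].
    now apply profile_is_calV.
Qed.

Lemma vanishing_speed_alpha_V (sigma : R) : 0 < sigma ->
  (exists V, is_alpha_V w a f sigma 0 V /\ filterlim V (at_right 0) (locally 0)) <->
  vanishing_speed F G sigma.
Proof.
  intros Hs.
  assert (forall V, profile_solution F G sigma V -> filterlim V (at_right 0) (locally (V 0))) as Hlim.
  { intros V HV. apply filterlim_within_of_continuous, HV. }
  split.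
  - intros [W [[_ [HW _]] HW0]]. split; [lra|].
    destruct (profile_solution_exists F G sigma HFG) as [V HV]; [lra|]. exists V. split; [assumption|].
    apply (filterlim_locally_unique (F := at_right 0) V); [now apply Hlim|].
    apply (filterlim_within_local (fun u => 0 < u) _ W); [|exact HW0].
    generalize (locally_between (-1) 1 0 ltac:(lra)). apply filter_imp.
    intros x Hx H. split; [exact H|]. apply (V_solution_unique sigma 0 V W HV); [lra|assumption|lra].
  - intros [_ [V [HV HV0]]]. exists V. split; [now apply profile_is_alpha_V|].
    specialize (Hlim V HV). now rewrite HV0 in Hlim.
Qed.

Lemma sigma_r_eq (m : R) : 0 <= m ->
  (forall sigma, vanishing_speed F G sigma <-> m <= sigma) -> sigma_r w a f = Finite m.
Proof.
  intros Hm0 Hm. apply is_glb_Rbar_unique. split.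
  - intros x [Hx HV]. apply Hm. now apply vanishing_speed_alpha_V.
  - intros b Hb. destruct b as [b| |]; simpl; [|exfalso|exact I].
    (* [sigma_r] admits positive speeds only, so [m] itself is missing when [m = 0]; the speeds
       [m + e] still force [b <= m]. *)
    + apply le_epsilon. intros e He. apply (Hb (m + e)). split; [lra|].
      apply vanishing_speed_alpha_V; [lra|]. apply Hm. lra.
    + apply (Hb (m + 1)). split; [lra|]. apply vanishing_speed_alpha_V; [lra|]. apply Hm. lra.
Qed.

(* a(u,s) is comparable to s for small s >= 0, because the s-derivative is continuous
   and positive at (u0, 0); hence g(u,v) is comparable to v. *)
Lemma g_comparable (u0 : R) : I01 u0 -> exists c C r, 0 < c /\ 0 < C /\ 0 < r /\
  forall u v, I01 u -> Rabs (u - u0) < r -> 0 <= v < r ->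
    c * v <= g w a u v <= C * v.
Proof.
  intros Hu0. destruct HaC1 as [_ [Hex Hcont]].
  pose proof (Omega_0 w a f Hst u0 Hu0) as HO0. set (A := Derive (fun r => a u0 r) 0).
  assert (0 < A) as HA by now apply Ha_s.
  destruct (continuous_on_Omega_eps w a f Hst _ u0 0 (A / 2) Hcont HO0) as [d [Hd Hda]]; [lra|].
  simpl in Hda. fold A in Hda.
  (* Continuity of [g] at [(u0, 0)] brings s = g(u,v) into the range where the derivative is within
     [A / 2] of [A]. *)
  destruct (g_clamped_continuous w a f Hst Ha_plus u0 0 (mkposreal d Hd)) as [r Hr]. simpl in Hr.
  pose proof (cond_pos r). pose proof (Rmin_l r d). pose proof (Rmin_r r d).
  (* The mean value theorem gives (A/2) s <= v <= 2 A s, whence the two constants. *)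
  exists (/ (2 * A)), (2 / A), (Rmin r d).
  split; [apply Rinv_0_lt_compat; lra|]. split; [apply Rdiv_lt_0_compat; lra|].
  split; [now apply Rmin_pos|].
  intros u v Hu Huu0 Hv.
  assert (Rabs (v - 0) < r) as Hvr by (apply Rabs_def1; lra).
  specialize (Hr u v ltac:(lra) Hvr).
  fold G in Hr. rewrite (G_0 F G HFG) in Hr.
  assert (0 <= G u v) as Hg0.
  { rewrite <- (G_0 F G HFG u). apply (G_le F G HFG). lra. }
  unfold G, g_clamped in Hr, Hg0. rewrite clamp_id in Hr, Hg0 by exact Hu.
  destruct (g_spec w a f Hst Ha_plus u v Hu) as [HOs Has]. set (s := g w a u v) in *.
  apply Rabs_def2 in Hr.
  assert (forall x, 0 <= x <= s -> Omega w (u, x) /\ Rabs (Derive (fun r => a u r) x - A) < A / 2) as Hx.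
  { intros x Hx. apply Hda; [assumption|lra|]. apply Rabs_def1; lra. }
  destruct (MVT_gen (a u) 0 s (Derive (fun r => a u r))) as [c [Hc E]].
  - rewrite Rmin_left, Rmax_right by lra. intros x Hx'. apply Derive_correct, Hex, Hx. lra.
  - rewrite Rmin_left, Rmax_right by lra. intros x Hx'. apply continuity_pt_filterlim.
    apply (flux_continuous_s w a f Hst), Hx. lra.
  - rewrite Rmin_left, Rmax_right in Hc by lra. destruct (Hx c Hc) as [_ Hca].
    apply Rabs_def2 in Hca. rewrite Has, (flux_0 w a f Hst u Hu) in E.
    set (k := Derive (fun r => a u r) c) in *.
    assert (A / 2 * s <= k * s) by (apply Rmult_le_compat_r; lra).
    assert (k * s <= 2 * A * s) by (apply Rmult_le_compat_r; lra).
    split.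
    + apply Rmult_le_reg_l with (2 * A); [lra|]. rewrite <- Rmult_assoc, Rinv_r by lra. lra.
    + apply Rmult_le_reg_l with (A / 2); [lra|].
      replace (A / 2 * (2 / A * v)) with v by (field; lra). lra.
Qed.

(* Near u = 0 both f and g(u,u) are of order u, so the quotient stays bounded. *)
Lemma ratio_on_diagonal_bounded : exists B, 0 <= B /\
  forall u, 0 < u < 1 -> F u / G u u <= B.
Proof.
  assert (I01 0) as H0 by (unfold I01; lra).
  destruct (g_comparable 0 H0) as [c [C [r [Hc [HC [Hr Hg]]]]]].
  destruct (reaction_local_lipschitz w a f Hst 0 H0) as [K [d [HK [Hd Hf]]]].
  rewrite (reaction_0 w a f Hst) in Hf.
  set (e := Rmin (Rmin r d) 1).
  assert (0 < e /\ e <= r /\ e <= d /\ e <= 1) as He.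
  { unfold e. pose proof (Rmin_l (Rmin r d) 1). pose proof (Rmin_r (Rmin r d) 1).
    pose proof (Rmin_l r d). pose proof (Rmin_r r d).
    assert (0 < Rmin (Rmin r d) 1) by (repeat apply Rmin_pos; lra). lra. }
  (* Away from 0 compactness suffices, [G u u] being positive up to [u = 1]; the linear bounds serve
     only for [u < e / 2]. *)
  destruct (continuity_ab_maj (fun u => F u / G u u) (e / 2) 1) as [m [Hm _]]; [lra| |].
  { intros u Hu. apply continuity_pt_filterlim.
    apply (continuous_mult (K := R_AbsRing) F (fun x => / G x x)); [apply (F_continuous F G HFG)|].
    apply (continuous_comp (fun x => G x x) Rinv).
    - apply continuous_comp_2d; [apply (G_continuous F G HFG)|apply continuous_id|apply continuous_id].
    - apply continuity_pt_filterlim, continuity_pt_inv; [apply continuity_pt_id|].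
      pose proof (G_pos F G HFG u u). unfold id. lra. }
  exists (Rmax (F m / G m m) (K / c)).
  assert (0 < K / c) by now apply Rdiv_lt_0_compat.
  split; [apply Rle_trans with (K / c); [lra|apply Rmax_r]|].
  intros u Hu. destruct (Rle_lt_dec (e / 2) u) as [Heu|Heu].
  - apply Rle_trans with (2 := Rmax_l _ _). apply Hm. lra.
  - apply Rle_trans with (2 := Rmax_r _ _).
    assert (I01 u) as HI by (unfold I01; lra).
    assert (Rabs (u - 0) < r) as Hur by (apply Rabs_def1; lra).
    assert (Rabs (u - 0) < d) as Hud by (apply Rabs_def1; lra).
    specialize (Hg u u HI Hur ltac:(lra)). specialize (Hf u HI Hud).
    rewrite !Rminus_0_r, (Rabs_pos_eq u) in Hf by lra.
    pose proof (Rle_abs (f u)).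
    rewrite clamped_ratio by assumption.
    assert (0 < c * u) by (apply Rmult_lt_0_compat; lra).
    apply Rmult_le_reg_r with (g w a u u); [lra|].
    unfold Rdiv at 1. rewrite Rmult_assoc, Rinv_l, Rmult_1_r by lra.
    apply Rle_trans with (K / c * (c * u)).
    + replace (K / c * (c * u)) with (K * u) by (field; lra). lra.
    + apply Rmult_le_compat_l; lra.
Qed.

End Speeds.

(** * From waves to profiles *)

(** By strict monotonicity [P y - h] and [P y + h] have images on either side of [y], and any [z]
    between these images has [P z] between those points. *)
Lemma continuous_inverse_increasing (I : R -> Prop) (X P : R -> R) (y : R) :
  (forall x, I x -> locally x I) ->
  (forall x z, I x -> I z -> x < z -> X x < X z) ->
  locally y (fun z => I (P z) /\ X (P z) = z) ->
  continuous P y.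
Proof.
  intros HI Hincr Hloc. destruct (locally_singleton _ _ Hloc) as [HIy HXy].
  destruct (HI _ HIy) as [r0 Hr0]. destruct Hloc as [r1 Hr1].
  pose proof (cond_pos r0). pose proof (cond_pos r1).
  apply continuous_eps. intros e He.
  set (h := Rmin e r0 / 2).
  assert (0 < h /\ h < e /\ h < r0) as Hh.
  { unfold h. pose proof (Rmin_l e r0). pose proof (Rmin_r e r0).
    assert (0 < Rmin e r0) by (apply Rmin_pos; lra). lra. }
  assert (forall k, Rabs k < r0 -> I (P y + k)) as HI'.
  { intros k Hk. apply Hr0. change (Rabs (P y + k - P y) < r0).
    now replace (P y + k - P y) with k by ring. }
  assert (I (P y + - h)) as Hm by (apply HI', Rabs_def1; lra).
  assert (I (P y + h)) as Hp by (apply HI', Rabs_def1; lra).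
  pose proof (Hincr _ _ Hm HIy ltac:(lra)). pose proof (Hincr _ _ HIy Hp ltac:(lra)).
  rewrite HXy in *.
  set (d := Rmin r1 (Rmin (y - X (P y + - h)) (X (P y + h) - y))).
  assert (0 < d /\ d <= r1 /\ d <= y - X (P y + - h) /\ d <= X (P y + h) - y) as Hd.
  { unfold d. pose proof (Rmin_l r1 (Rmin (y - X (P y + - h)) (X (P y + h) - y))).
    pose proof (Rmin_r r1 (Rmin (y - X (P y + - h)) (X (P y + h) - y))).
    pose proof (Rmin_l (y - X (P y + - h)) (X (P y + h) - y)).
    pose proof (Rmin_r (y - X (P y + - h)) (X (P y + h) - y)).
    assert (0 < Rmin r1 (Rmin (y - X (P y + - h)) (X (P y + h) - y))) by (repeat apply Rmin_pos; lra).
    lra. }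
  exists d. split; [tauto|]. intros z Hz.
  destruct (Hr1 z) as [HIz HXz]; [change (Rabs (z - y) < r1); lra|].
  apply Rabs_def2 in Hz.
  assert (forall x x', I x -> I x' -> X x < X x' -> x < x') as Hinv.
  { intros x x' Hx Hx' HX. destruct (Rtotal_order x x') as [|[<-|Hlt]]; [assumption|lra|].
    pose proof (Hincr _ _ Hx' Hx Hlt). lra. }
  assert (P y + - h < P z) by (apply Hinv; auto; lra).
  assert (P z < P y + h) by (apply Hinv; auto; lra).
  apply Rabs_def1; lra.
Qed.

Lemma is_derive_inverse (X P : R -> R) (y d : R) :
  continuous P y -> locally y (fun z => X (P z) = z) ->
  is_derive X (P y) d -> 0 < d -> is_derive P y (/ d).
Proof.
  intros Hc Hloc HX Hd. apply is_derive_eps. intros e He.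
  (* The first bound gives [d |D| <= 2 |z - y|], turning an error relative to [D] into one relative
     to [z - y]; the second leaves [e |z - y|] after division by [d]. *)
  set (e1 := Rmin (d / 2) (e * d * d / 2)).
  assert (0 < e * d * d) as Hedd by (repeat apply Rmult_lt_0_compat; lra).
  assert (0 < e1 /\ e1 <= d / 2 /\ e1 <= e * d * d / 2) as He1.
  { unfold e1. split; [apply Rmin_pos; lra|]. split; [apply Rmin_l|apply Rmin_r]. }
  destruct (proj1 (is_derive_eps X (P y) d) HX e1 (proj1 He1)) as [r [Hr HXr]].
  destruct (proj1 (continuous_eps P y) Hc r Hr) as [r1 [Hr1 HPr]].
  pose proof (locally_singleton _ _ Hloc) as Hy. simpl in Hy.
  destruct Hloc as [r2 Hr2]. pose proof (cond_pos r2).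
  exists (Rmin r1 r2). split; [now apply Rmin_pos|]. intros z Hz.
  pose proof (Rmin_l r1 r2). pose proof (Rmin_r r1 r2).
  assert (X (P z) = z) as Hz' by (apply Hr2; change (Rabs (z - y) < r2); lra).
  specialize (HXr (P z) (HPr z ltac:(lra))). rewrite Hz', Hy in HXr.
  set (D := P z - P y) in *.
  assert (d * Rabs D <= 2 * Rabs (z - y)) as HD.
  { assert (d * Rabs D <= Rabs (z - y) + e1 * Rabs D).
    { replace (d * Rabs D) with (Rabs (d * D)) by (rewrite Rabs_mult, (Rabs_pos_eq d); lra).
      replace (d * D) with ((z - y) - (z - y - d * D)) by ring.
      eapply Rle_trans; [apply Rabs_triang|]. rewrite Rabs_Ropp. lra. }
    assert (e1 * Rabs D <= d / 2 * Rabs D) by (apply Rmult_le_compat_r; [apply Rabs_pos|lra]).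
    lra. }
  apply Rmult_le_reg_l with d; [assumption|].
  replace (d * Rabs (D - / d * (z - y))) with (Rabs (z - y - d * D)).
  2:{ rewrite <- (Rabs_pos_eq d) at 2 by lra. rewrite <- Rabs_mult, <- Rabs_Ropp.
      f_equal. field. lra. }
  apply Rle_trans with (1 := HXr).
  apply Rle_trans with (e * d * d / 2 * Rabs D).
  - apply Rmult_le_compat_r; [apply Rabs_pos|lra].
  - replace (e * d * d / 2 * Rabs D) with (e * d / 2 * (d * Rabs D)) by field.
    replace (d * (e * Rabs (z - y))) with (e * d / 2 * (2 * Rabs (z - y))) by field.
    apply Rmult_le_compat_l; [|assumption].
    assert (0 < e * d) by (apply Rmult_lt_0_compat; lra). lra.
Qed.

Lemma derive_nonneg_of_right_min (h : R -> R) (x l : R) :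
  is_derive h x l -> (forall y, x < y -> h x <= h y) -> 0 <= l.
Proof.
  intros Hh Hmin. apply Rnot_lt_le. intros Hl.
  destruct (proj1 (is_derive_eps h x l) Hh (- l / 2)) as [d [Hd H]]; [lra|].
  specialize (H (x + d / 2)). replace (x + d / 2 - x) with (d / 2) in H by ring.
  rewrite (Rabs_pos_eq (d / 2)) in H by lra. specialize (H ltac:(lra)).
  apply Rabs_le_between in H. specialize (Hmin (x + d / 2) ltac:(lra)).
  assert (0 < - l * d) by (apply Rmult_lt_0_compat; lra). lra.
Qed.

Lemma derive_zero_of_min (h : R -> R) (x l : R) :
  is_derive h x l -> (forall y, h x <= h y) -> l = 0.
Proof.
  intros Hh Hmin. apply Rle_antisym.
  - assert (0 <= - l); [|lra].
    apply (derive_nonneg_of_right_min (fun y => h (- y)) (- x)).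
    + rewrite <- (Ropp_involutive x) in Hh.
      replace (- l) with (scal (-1) l) by (unfold scal; simpl; unfold mult; simpl; ring).
      apply (is_derive_comp h Ropp (- x)); [assumption|]. auto_derive; [exact I|ring].
    + intros y _. rewrite Ropp_involutive. apply Hmin.
  - apply (derive_nonneg_of_right_min h x); [assumption|]. auto.
Qed.

Section WaveGivesProfile.

Variables (w : R -> Rbar) (a : R -> R -> R) (f : R -> R).
Hypotheses (Hst : standing_assumptions w a f)
  (Ha_plus : forall u, I01 u -> a_plus w a u = p_infty).

Let F := reaction_clamped f.
Let G := g_clamped w a.

Variables (sigma : R) (u : R -> R).
Hypothesis Hu : classic_profile w a f sigma u.

Let v (x : R) : R := a (u x) (Derive u x).

Lemma u_incr (x y : R) : x < y -> u x < u y.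
Proof. apply Hu. Qed.

Lemma wave_is_derive (x : R) : is_derive u x (Derive u x).
Proof. apply Derive_correct. destruct Hu as [H _]. apply H. Qed.

Lemma wave_continuous (x : R) : continuous u x.
Proof. exact (is_derive_continuous _ _ _ (wave_is_derive x)). Qed.

Lemma wave_Omega (x : R) : Omega w (u x, Derive u x).
Proof. apply Hu. Qed.

Lemma wave_range (x : R) : 0 < u x < 1.
Proof.
  pose proof (u_incr (x - 1) x ltac:(lra)). pose proof (u_incr x (x + 1) ltac:(lra)).
  destruct Hu as [_ [_ [H01 _]]]. pose proof (H01 (x - 1)). pose proof (H01 (x + 1)). lra.
Qed.

Lemma wave_flux_derive (x : R) : is_derive v x (sigma * Derive u x - f (u x)).
Proof.
  destruct Hu as [_ [_ [_ [_ [_ [_ H]]]]]]. destruct (H x) as [Hex HD].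
  replace (sigma * Derive u x - f (u x)) with (Derive v x) by (unfold v; lra).
  now apply Derive_correct.
Qed.

Lemma wave_slope_nonneg (x : R) : 0 <= Derive u x.
Proof.
  apply (derive_nonneg_of_right_min u x); [apply wave_is_derive|].
  intros y Hy. left. now apply u_incr.
Qed.

Lemma flux_nonneg (p s : R) : Omega w (p, s) -> 0 <= s -> 0 <= a p s.
Proof.
  intros HO Hs. pose proof (flux_0 w a f Hst p (proj1 HO)) as H0.
  destruct Hs as [Hs|<-]; [|rewrite H0; apply Rle_refl].
  assert (a p 0 < a p s); [|lra].
  apply (flux_increasing w a f Hst); [|assumption|assumption].
  apply (Omega_0 w a f Hst), HO.
Qed.

(* At a critical point of u the flux would attain its minimum 0, and the equation
   would give f(u) = 0. *)
Lemma wave_slope_pos (x : R) : 0 < Derive u x.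
Proof.
  destruct (wave_slope_nonneg x) as [|H0]; [assumption|exfalso].
  pose proof (wave_range x) as Hx.
  assert (sigma * Derive u x - f (u x) = 0) as E.
  { apply (derive_zero_of_min v x); [apply wave_flux_derive|]. intros y. unfold v at 1.
    rewrite <- H0, (flux_0 w a f Hst) by (unfold I01; lra).
    apply flux_nonneg; [apply wave_Omega|apply wave_slope_nonneg]. }
  pose proof (reaction_pos w a f Hst (u x) Hx). rewrite <- H0 in E. lra.
Qed.

Lemma wave_flux_pos (x : R) : 0 < v x.
Proof.
  pose proof (wave_Omega x) as HO. unfold v.
  rewrite <- (flux_0 w a f Hst (u x) (proj1 HO)).
  apply (flux_increasing w a f Hst); [|assumption|apply wave_slope_pos].
  apply (Omega_0 w a f Hst), HO.
Qed.

(** The equation says that [sigma u - v] has derivative f(u) >= 0. This carries smallness of the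
    flux from one point to all later ones. *)
Lemma wave_flux_bound (x y : R) : x <= y -> v y <= v x + Rabs sigma * (u y - u x).
Proof.
  intros Hxy.
  assert (sigma * u x - v x <= sigma * u y - v y) as Hle.
  { assert (forall z, is_derive (fun z => sigma * u z - v z) z (f (u z))) as HD.
    { intros z. replace (f (u z)) with (sigma * Derive u z - (sigma * Derive u z - f (u z))) by ring.
      apply (is_derive_minus (V := R_NormedModule)); [|apply wave_flux_derive].
      apply (is_derive_scal u z sigma), wave_is_derive. }
    apply (derive_nonneg_le (fun z => sigma * u z - v z) (fun z => f (u z))); auto.
    - intros z _. exact (is_derive_continuous _ _ _ (HD z)).
    - intros z _. left. apply (reaction_pos w a f Hst), wave_range. }
  assert (sigma * (u y - u x) <= Rabs sigma * (u y - u x)); [|lra].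
  apply Rmult_le_compat_r; [|apply Rle_abs].
  destruct Hxy as [Hxy|<-]; [|lra]. pose proof (u_incr x y Hxy). lra.
Qed.

(** Over a length [1 / d] the wave rises by less than 1. *)
Lemma wave_small_slope (z d : R) : 0 < d -> exists c, z <= c <= z + / d /\ Derive u c < d.
Proof.
  intros Hd. pose proof (Rinv_0_lt_compat d Hd).
  destruct (MVT_gen u z (z + / d) (Derive u)) as [c [Hc E]].
  - intros; apply wave_is_derive.
  - intros; apply continuity_pt_filterlim, wave_continuous.
  - rewrite Rmin_left, Rmax_right in Hc by lra. exists c. split; [assumption|].
    pose proof (wave_range z). pose proof (wave_range (z + / d)).
    apply Rmult_lt_reg_r with (/ d); [assumption|].
    rewrite Rinv_r by lra. replace (z + / d - z) with (/ d) in E by ring. lra.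
Qed.

Lemma wave_surjective (p : R) : 0 < p < 1 -> exists x, u x = p.
Proof.
  intros Hp. destruct Hu as [_ [_ [_ [_ [Hm [Hp' _]]]]]].
  assert (exists x1, u x1 < p) as [x1 Hx1].
  { assert (Rbar_locally' m_infty (fun x => u x < p)) as [M HM].
    { apply (Hm (fun y => y < p)). apply open_lt. simpl. lra. }
    exists (M - 1). apply HM. lra. }
  assert (exists x2, p < u x2) as [x2 Hx2].
  { assert (Rbar_locally' p_infty (fun x => p < u x)) as [M HM].
    { apply (Hp' (fun y => p < y)). apply open_gt. simpl. lra. }
    exists (M + 1). apply HM. lra. }
  assert (x1 < x2) as H12.
  { destruct (Rtotal_order x1 x2) as [|[->|Hlt]]; [assumption|lra|]. apply u_incr in Hlt. lra. }
  destruct (Ranalysis5.IVT_interv (fun x => u x - p) x1 x2) as [x [_ Hx]]; try lra.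
  - intros x _. apply continuity_pt_filterlim.
    apply (continuous_minus (V := R_NormedModule)); [apply wave_continuous|apply continuous_const].
  - exists x. lra.
Qed.

Definition wave_position (p : R) : R := epsilon (inhabits 0) (fun x => u x = p).

Lemma wave_position_spec (p : R) : 0 < p < 1 -> u (wave_position p) = p.
Proof. intros Hp. unfold wave_position. apply epsilon_spec. now apply wave_surjective. Qed.

(** Candidate for V_sigma, extended by 0 so that vanishing at both ends becomes plain continuity at
    0 and 1. *)
Definition wave_flux_of_value (p : R) : R :=
  if Rlt_dec 0 p then if Rlt_dec p 1 then v (wave_position p) else 0 else 0.

Lemma wave_flux_of_value_eq (p : R) : 0 < p < 1 -> wave_flux_of_value p = v (wave_position p).
Proof.
  intros Hp. unfold wave_flux_of_value.
  destruct (Rlt_dec 0 p); [|lra]. destruct (Rlt_dec p 1); [reflexivity|lra].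
Qed.

Lemma wave_flux_of_value_out (p : R) : p <= 0 \/ 1 <= p -> wave_flux_of_value p = 0.
Proof.
  intros Hp. unfold wave_flux_of_value.
  destruct (Rlt_dec 0 p); [|reflexivity]. destruct (Rlt_dec p 1); [lra|reflexivity].
Qed.

(** Chain rule along the inverse of the wave: dv/du = v'/u' = sigma - f(u)/u', and u' = g(u,v) by
    definition of the flux. *)
Lemma wave_flux_of_value_derive (p : R) : 0 < p < 1 ->
  is_derive wave_flux_of_value p (sigma - F p / G p (wave_flux_of_value p)).
Proof.
  intros Hp. pose proof (locally_between 0 1 p Hp) as Hloc.
  set (x := wave_position p). assert (u x = p) as Hx by now apply wave_position_spec.
  assert (is_derive wave_position p (/ Derive u x)) as HP.
  { apply (is_derive_inverse u).
    - apply (continuous_inverse_increasing (fun _ => True) u).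
      + intros z _. apply filter_true.
      + intros; now apply u_incr.
      + apply filter_imp with (2 := Hloc). intros z Hz. split; [exact I|]. now apply wave_position_spec.
    - apply filter_imp with (2 := Hloc). intros z Hz. now apply wave_position_spec.
    - apply wave_is_derive.
    - apply wave_slope_pos. }
  apply is_derive_ext_loc with (fun z => v (wave_position z)).
  { apply filter_imp with (2 := Hloc). intros z Hz. symmetry. now apply wave_flux_of_value_eq. }
  assert (G p (wave_flux_of_value p) = Derive u x) as HG.
  { rewrite wave_flux_of_value_eq by assumption. fold x. unfold G, g_clamped, v.
    rewrite clamp_id, <- Hx by lra. apply (g_unique w a f Hst Ha_plus), wave_Omega. }
  assert (F p = f (u x)) as HF by (unfold F, reaction_clamped; now rewrite clamp_id, Hx by lra).
  pose proof (wave_slope_pos x).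
  replace (sigma - F p / G p (wave_flux_of_value p))
    with (scal (/ Derive u x) (sigma * Derive u x - f (u x))).
  - apply (is_derive_comp v wave_position); [apply wave_flux_derive|exact HP].
  - rewrite HG, HF. unfold scal; simpl; unfold mult; simpl. field. lra.
Qed.

Lemma flux_small (p0 e : R) : I01 p0 -> 0 < e -> exists d, 0 < d /\
  forall p s, I01 p -> Rabs (p - p0) < d -> 0 <= s < d -> a p s < e.
Proof.
  intros Hp0 He.
  destruct (continuous_on_Omega_eps w a f Hst _ p0 0 e (flux_continuous w a f Hst)
    (Omega_0 w a f Hst p0 Hp0) He) as [d [Hd H]].
  exists d. split; [assumption|]. intros p s Hp Hpp Hs.
  destruct (H p s Hp Hpp) as [_ Ha]; [apply Rabs_def1; lra|].
  simpl in Ha. rewrite (flux_0 w a f Hst p0 Hp0) in Ha. apply Rabs_def2 in Ha. lra.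
Qed.

Lemma speed_term_small (e : R) : 0 < e -> exists d, 0 < d /\
  forall t, 0 <= t <= d -> Rabs sigma * t <= e.
Proof.
  intros He. pose proof (Rabs_pos sigma). exists (e / (Rabs sigma + 1)).
  split; [apply Rdiv_lt_0_compat; lra|]. intros t Ht.
  apply Rle_trans with ((Rabs sigma + 1) * (e / (Rabs sigma + 1))); [|right; field; lra].
  apply Rmult_le_compat; lra.
Qed.

(** It is not known that u' tends to 0, but each [y] has a point [c] at bounded distance to its left
    with small slope, hence small flux; [wave_flux_bound] brings this to [y], since [u y - u c] is
    small too. *)
Lemma wave_flux_vanishes_0 (e : R) : 0 < e -> exists d, 0 < d /\
  forall p, 0 < p < 1 -> p < d -> wave_flux_of_value p < e.
Proof.
  intros He. destruct (flux_small 0 (e / 2)) as [d1 [Hd1 Ha]]; [unfold I01; lra|lra|].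
  destruct (speed_term_small (e / 2)) as [d2 [Hd2 Hs]]; [lra|].
  pose proof (Rmin_l d1 d2). pose proof (Rmin_r d1 d2).
  exists (Rmin d1 d2). split; [now apply Rmin_pos|]. intros p Hp Hpd.
  rewrite wave_flux_of_value_eq by assumption.
  pose proof (wave_position_spec p Hp) as Hy. set (y := wave_position p) in *.
  destruct (wave_small_slope (y - / d1) d1 Hd1) as [c [Hc Hcs]].
  pose proof (wave_range c) as Hrc.
  assert (u c <= u y) as Hcy.
  { destruct (Req_dec c y) as [->|]; [lra|]. left. apply u_incr. lra. }
  pose proof (wave_flux_bound c y ltac:(lra)).
  specialize (Hs (u y - u c) ltac:(lra)).
  assert (v c < e / 2); [|lra].
  apply Ha; [unfold I01; lra|apply Rabs_def1; lra|].
  split; [apply wave_slope_nonneg|assumption].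
Qed.

(** Here one point [c] of small slope, with [u c] close to 1, controls the flux at all later points;
    [1 - u c] is therefore the required distance. *)
Lemma wave_flux_vanishes_1 (e : R) : 0 < e -> exists d, 0 < d /\
  forall p, 0 < p < 1 -> 1 - d < p -> wave_flux_of_value p < e.
Proof.
  intros He. destruct (flux_small 1 (e / 2)) as [d1 [Hd1 Ha]]; [unfold I01; lra|lra|].
  destruct (speed_term_small (e / 2)) as [d2 [Hd2 Hs]]; [lra|].
  set (d := Rmin (Rmin d1 d2) 1).
  assert (0 < d /\ d <= d1 /\ d <= d2 /\ d <= 1) as Hd.
  { unfold d. pose proof (Rmin_l (Rmin d1 d2) 1). pose proof (Rmin_r (Rmin d1 d2) 1).
    pose proof (Rmin_l d1 d2). pose proof (Rmin_r d1 d2).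
    assert (0 < Rmin (Rmin d1 d2) 1) by (repeat apply Rmin_pos; lra). lra. }
  pose proof (wave_position_spec (1 - d / 2) ltac:(lra)) as Hz.
  destruct (wave_small_slope (wave_position (1 - d / 2)) d1 Hd1) as [c [Hc Hcs]].
  pose proof (wave_range c) as Hrc.
  assert (1 - d / 2 <= u c) as Huc.
  { rewrite <- Hz. destruct (Req_dec (wave_position (1 - d / 2)) c) as [->|]; [lra|].
    left. apply u_incr. lra. }
  exists (1 - u c). split; [lra|]. intros p Hp Hpd.
  rewrite wave_flux_of_value_eq by assumption.
  pose proof (wave_position_spec p Hp) as Hy. set (y := wave_position p) in *.
  assert (c < y) as Hcy.
  { destruct (Rtotal_order c y) as [|[->|Hlt]]; [assumption|lra|]. apply u_incr in Hlt. lra. }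
  pose proof (wave_flux_bound c y ltac:(lra)).
  specialize (Hs (u y - u c) ltac:(lra)).
  assert (v c < e / 2); [|lra].
  apply Ha; [unfold I01; lra|apply Rabs_def1; lra|].
  split; [apply wave_slope_nonneg|assumption].
Qed.

Lemma wave_flux_of_value_continuous (p : R) : continuous wave_flux_of_value p.
Proof.
  assert (forall q, 0 < q < 1 -> 0 < wave_flux_of_value q) as Hpos.
  { intros q Hq. rewrite wave_flux_of_value_eq by assumption. apply wave_flux_pos. }
  destruct (Rlt_dec 0 p) as [H0|H0].
  - destruct (Rtotal_order p 1) as [H1|[->|H1]].
    + exact (is_derive_continuous _ _ _ (wave_flux_of_value_derive p (conj H0 H1))).
    + apply continuous_eps. intros e He. destruct (wave_flux_vanishes_1 e He) as [d [Hd H]].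
      exists (Rmin d 1). split; [apply Rmin_pos; lra|]. intros y Hy.
      pose proof (Rmin_l d 1). pose proof (Rmin_r d 1). apply Rabs_def2 in Hy.
      rewrite (wave_flux_of_value_out 1), Rminus_0_r by lra.
      destruct (Rlt_dec y 1).
      * rewrite Rabs_pos_eq by (left; apply Hpos; lra). apply H; lra.
      * rewrite wave_flux_of_value_out, Rabs_R0 by lra. assumption.
    + apply continuous_ext_loc with (fun _ => 0); [|apply continuous_const].
      generalize (locally_between 1 (p + 1) p ltac:(lra)). apply filter_imp.
      intros y Hy. symmetry. apply wave_flux_of_value_out. lra.
  - destruct (Req_dec p 0) as [->|Hp].
    + apply continuous_eps. intros e He. destruct (wave_flux_vanishes_0 e He) as [d [Hd H]].
      exists (Rmin d 1). split; [apply Rmin_pos; lra|]. intros y Hy.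
      pose proof (Rmin_l d 1). pose proof (Rmin_r d 1). apply Rabs_def2 in Hy.
      rewrite (wave_flux_of_value_out 0), Rminus_0_r by lra.
      destruct (Rlt_dec 0 y).
      * rewrite Rabs_pos_eq by (left; apply Hpos; lra). apply H; lra.
      * rewrite wave_flux_of_value_out, Rabs_R0 by lra. assumption.
    + apply continuous_ext_loc with (fun _ => 0); [|apply continuous_const].
      generalize (locally_between (p - 1) 0 p ltac:(lra)). apply filter_imp.
      intros y Hy. symmetry. apply wave_flux_of_value_out. lra.
Qed.

(* A nonpositive speed would make the flux profile decreasing on (0,1), while it
   vanishes at both ends. *)
Lemma wave_speed_pos : 0 < sigma.
Proof.
  apply Rnot_le_lt. intros Hs.
  assert (- wave_flux_of_value 0 <= - wave_flux_of_value (1 / 2)) as Hle.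
  { apply (derive_nonneg_le (fun p => - wave_flux_of_value p)
      (fun p => - (sigma - F p / G p (wave_flux_of_value p)))); [lra| | |].
    - intros p Hp. apply (is_derive_opp (V := R_NormedModule)), wave_flux_of_value_derive. lra.
    - intros p _. apply (continuous_opp (V := R_NormedModule)), wave_flux_of_value_continuous.
    - intros p Hp. pose proof (clamped_regular_data w a f Hst Ha_plus) as HFG. fold F G in HFG.
      assert (0 < wave_flux_of_value p) as Hpos.
      { rewrite wave_flux_of_value_eq by lra. apply wave_flux_pos. }
      assert (0 < F p / G p (wave_flux_of_value p)); [|lra].
      apply Rdiv_lt_0_compat; [apply (F_pos F G HFG); lra|now apply (G_pos F G HFG)]. }
  rewrite (wave_flux_of_value_out 0) in Hle by lra.
  rewrite wave_flux_of_value_eq in Hle by lra.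
  pose proof (wave_flux_pos (wave_position (1 / 2))). lra.
Qed.

Lemma classic_profile_vanishing_speed : vanishing_speed F G sigma.
Proof.
  split; [left; apply wave_speed_pos|]. exists wave_flux_of_value.
  split; [|apply wave_flux_of_value_out; lra].
  split; [apply wave_flux_of_value_continuous|]. split; [apply wave_flux_of_value_out; lra|].
  intros p Hp. split; [|now apply wave_flux_of_value_derive].
  rewrite wave_flux_of_value_eq by assumption. apply wave_flux_pos.
Qed.

End WaveGivesProfile.

(** * From profiles to waves *)

(** [h + k ln] is nonincreasing, so [h t >= h t1 + k (ln t1 - ln t)], which is unbounded as
    [t -> 0]. *)
Lemma log_divergence (h h' : R -> R) (k t1 M : R) : 0 < k -> 0 < t1 ->
  (forall t, 0 < t <= t1 -> is_derive h t (h' t)) ->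
  (forall t, 0 < t <= t1 -> h' t <= - (k / t)) ->
  exists t, 0 < t <= t1 /\ M < h t.
Proof.
  intros Hk Ht1 Hh Hh'.
  (* The exponent makes the logarithmic gain at least [|M - h t1| + 1]; the minimum keeps
     [t <= t1]. *)
  set (t := Rmin t1 (exp (ln t1 - (Rabs (M - h t1) + 1) / k))).
  assert (0 < t) as Ht by (apply Rmin_pos; [assumption|apply exp_pos]).
  assert (t <= t1) as Htt by apply Rmin_l.
  assert (ln t <= ln t1 - (Rabs (M - h t1) + 1) / k) as Hln.
  { rewrite <- (ln_exp (ln t1 - (Rabs (M - h t1) + 1) / k)).
    apply ln_le; [assumption|apply Rmin_r]. }
  exists t. split; [lra|].
  assert (forall s, 0 < s <= t1 -> is_derive (fun s => - (h s + k * ln s)) s (- (h' s + k * / s))) as HD.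
  { intros s Hs. apply (is_derive_opp (V := R_NormedModule) (fun s => h s + k * ln s)).
    apply (is_derive_plus (V := R_NormedModule)); [now apply Hh|].
    apply (is_derive_scal ln s k). apply is_derive_Reals, derivable_pt_lim_ln. lra. }
  assert (- (h t + k * ln t) <= - (h t1 + k * ln t1)) as Hle.
  { apply (derive_nonneg_le (fun s => - (h s + k * ln s)) (fun s => - (h' s + k * / s)));
      [assumption| | |].
    - intros s Hs. apply HD. lra.
    - intros s Hs. apply (is_derive_continuous _ _ (- (h' s + k * / s))), HD. lra.
    - intros s Hs. specialize (Hh' s ltac:(lra)). unfold Rdiv in Hh'. lra. }
  assert (k * ln t <= k * ln t1 - (Rabs (M - h t1) + 1)).
  { apply Rle_trans with (k * (ln t1 - (Rabs (M - h t1) + 1) / k)).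
    - apply Rmult_le_compat_l; lra.
    - right. field. lra. }
  pose proof (Rle_abs (M - h t1)). lra.
Qed.

Section ProfileGivesWave.

Variables (w : R -> Rbar) (a : R -> R -> R) (f : R -> R).
Hypotheses (Hst : standing_assumptions w a f)
  (HaC1 : C1_Omega w a)
  (Ha_s : forall u s, Omega w (u, s) -> 0 < Derive (fun r => a u r) s)
  (Ha_plus : forall u, I01 u -> a_plus w a u = p_infty).

Let F := reaction_clamped f.
Let G := g_clamped w a.
Let HFG : regular_data F G := clamped_regular_data w a f Hst Ha_plus.

Lemma continuous_on_Omega_comp (k : R * R -> R) (U h : R -> R) (x : R) :
  continuous_on (Omega w) k -> (forall y, Omega w (U y, h y)) ->
  continuous U x -> continuous h x -> continuous (fun y => k (U y, h y)) x.
Proof.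
  intros Hk HO HU Hh. apply continuous_eps. intros e He.
  destruct (continuous_on_Omega_eps w a f Hst k (U x) (h x) e Hk (HO x) He) as [d [Hd H]].
  destruct (proj1 (continuous_eps U x) HU d Hd) as [d1 [Hd1 H1]].
  destruct (proj1 (continuous_eps h x) Hh d Hd) as [d2 [Hd2 H2]].
  exists (Rmin d1 d2). split; [now apply Rmin_pos|]. intros y Hy.
  pose proof (Rmin_l d1 d2). pose proof (Rmin_r d1 d2).
  apply H; [apply (HO y)|apply H1; lra|apply H2; lra].
Qed.

(** For [u] inside (0,1), openness of [Omega] puts a full neighbourhood of [u] into the section at
    height [s]. *)
Lemma derive_within_interior (u s l : R) : 0 < u < 1 -> Omega w (u, s) ->
  derive_within (fun v => Omega w (v, s)) (fun v => a v s) u l ->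
  is_derive (fun v => a v s) u l.
Proof.
  intros Hu HO Hl. destruct (Omega_open w a f Hst u s HO) as [d [Hd HOd]].
  apply is_derive_eps. intros e He.
  destruct (proj1 (filterlim_locally _ _) Hl (mkposreal e He)) as [d1 Hd1].
  pose proof (cond_pos d1).
  set (r := Rmin (Rmin d d1) (Rmin u (1 - u))).
  assert (0 < r /\ r <= d /\ r <= d1 /\ r <= u /\ r <= 1 - u) as Hr.
  { unfold r. pose proof (Rmin_l (Rmin d d1) (Rmin u (1 - u))).
    pose proof (Rmin_r (Rmin d d1) (Rmin u (1 - u))).
    pose proof (Rmin_l d d1). pose proof (Rmin_r d d1).
    pose proof (Rmin_l u (1 - u)). pose proof (Rmin_r u (1 - u)).
    assert (0 < Rmin (Rmin d d1) (Rmin u (1 - u))) by (repeat apply Rmin_pos; lra). lra. }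
  exists r. split; [tauto|]. intros y Hy.
  destruct (Req_dec y u) as [->|Hne]; [rewrite !Rminus_diag, Rmult_0_r, Rminus_0_r, Rabs_R0; lra|].
  assert (Omega w (y, s)) as HOy.
  { apply HOd; [unfold I01; apply Rabs_def2 in Hy; lra|lra|rewrite Rminus_diag, Rabs_R0; lra]. }
  assert (Rabs (y - u) < d1) as Hyd by lra.
  specialize (Hd1 y Hyd Hne HOy). change (Rabs ((a y s - a u s) / (y - u) - l) < e) in Hd1.
  replace (a y s - a u s - l * (y - u)) with (((a y s - a u s) / (y - u) - l) * (y - u)) by (field; lra).
  rewrite Rabs_mult. apply Rmult_le_compat_r; [apply Rabs_pos|lra].
Qed.

(* The increment of a(U(x), .) from h(x0) to h(x) is a_s times the increment of h, by
   the mean value theorem. *)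
Lemma implicit_derive (U h : R -> R) (x0 dU dv au : R) :
  (forall x, Omega w (U x, h x)) -> 0 < U x0 < 1 ->
  is_derive U x0 dU -> continuous h x0 ->
  is_derive (fun x => a (U x) (h x)) x0 dv ->
  is_derive (fun p => a p (h x0)) (U x0) au ->
  is_derive h x0 ((dv - dU * au) / Derive (fun r => a (U x0) r) (h x0)).
Proof.
  intros HO HU0 HU Hh Hv Hau. destruct HaC1 as [_ [Hex Hcont]].
  set (A := Derive (fun r => a (U x0) r) (h x0)). set (n := dv - dU * au).
  assert (0 < A) as HA by apply Ha_s, HO.
  pose proof (Rabs_pos n) as Hn.
  apply is_derive_eps. intros e He.
  (* [B - 1] bounds the difference quotients of [h] at [x0]. The errors in the slope [S] and in the
     derivative [n] then add up to [eta (B - 1) + eta], which [eta <= e A / B] makes at most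
     [e A]. *)
  set (B := 2 * (Rabs n + 1) / A + 1).
  assert (1 <= B) as HB.
  { unfold B. assert (0 <= 2 * (Rabs n + 1) / A); [|lra].
    apply Rmult_le_pos; [lra|]. left. now apply Rinv_0_lt_compat. }
  set (eta := Rmin (Rmin 1 (A / 2)) (e * A / B)).
  assert (0 < e * A / B) as HeAB.
  { apply Rdiv_lt_0_compat; [apply Rmult_lt_0_compat|]; lra. }
  assert (0 < eta /\ eta <= 1 /\ eta <= A / 2 /\ eta <= e * A / B) as Heta.
  { unfold eta. pose proof (Rmin_l (Rmin 1 (A / 2)) (e * A / B)).
    pose proof (Rmin_r (Rmin 1 (A / 2)) (e * A / B)).
    pose proof (Rmin_l 1 (A / 2)). pose proof (Rmin_r 1 (A / 2)).
    assert (0 < Rmin (Rmin 1 (A / 2)) (e * A / B)) by (repeat apply Rmin_pos; lra). lra. }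
  assert (is_derive (fun x => a (U x) (h x) - a (U x) (h x0)) x0 n) as HN.
  { apply (is_derive_minus (V := R_NormedModule) (fun x => a (U x) (h x)) (fun x => a (U x) (h x0)));
      [assumption|].
    apply (is_derive_comp (fun p => a p (h x0)) U); assumption. }
  destruct (proj1 (is_derive_eps _ _ _) HN eta (proj1 Heta)) as [d1 [Hd1 HN1]].
  destruct (continuous_on_Omega_eps w a f Hst _ (U x0) (h x0) eta Hcont (HO x0) (proj1 Heta))
    as [d2 [Hd2 Hs]]. simpl in Hs. fold A in Hs.
  destruct (proj1 (continuous_eps h x0) Hh d2 Hd2) as [d3 [Hd3 Hh3]].
  destruct (proj1 (continuous_eps U x0) (is_derive_continuous _ _ _ HU) d2 Hd2) as [d4 [Hd4 HU4]].
  exists (Rmin d1 (Rmin d3 d4)). split; [repeat apply Rmin_pos; assumption|]. intros x Hx.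
  pose proof (Rmin_l d1 (Rmin d3 d4)). pose proof (Rmin_r d1 (Rmin d3 d4)).
  pose proof (Rmin_l d3 d4). pose proof (Rmin_r d3 d4).
  specialize (HN1 x ltac:(lra)). specialize (Hh3 x ltac:(lra)). specialize (HU4 x ltac:(lra)).
  rewrite (Rminus_diag (a (U x0) (h x0))), Rminus_0_r in HN1.
  assert (forall z, Rmin (h x0) (h x) <= z <= Rmax (h x0) (h x) ->
    Omega w (U x, z) /\ Rabs (Derive (fun r => a (U x) r) z - A) < eta) as Hz.
  { intros z Hz. apply Hs; [apply (HO x)|assumption|].
    apply Rabs_def2 in Hh3. unfold Rmin, Rmax in Hz. apply Rabs_def1; destruct Rle_dec; lra. }
  destruct (MVT_gen (a (U x)) (h x0) (h x) (Derive (fun r => a (U x) r))) as [xi [Hxi E]].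
  { intros z Hz'. apply Derive_correct, Hex, Hz. lra. }
  { intros z Hz'. apply continuity_pt_filterlim, (flux_continuous_s w a f Hst), Hz, Hz'. }
  rewrite E in HN1. destruct (Hz xi Hxi) as [_ HS].
  set (S := Derive (fun r => a (U x) r) xi) in *.
  set (D := h x - h x0) in *. set (t := x - x0) in *.
  pose proof (Rabs_pos t) as Htp. pose proof (Rabs_pos D) as HDp.
  apply Rabs_def2 in HS.
  assert (A / 2 * Rabs D <= (Rabs n + 1) * Rabs t) as HDb.
  { apply Rle_trans with (Rabs (S * D)).
    - rewrite Rabs_mult, (Rabs_pos_eq S) by lra. apply Rmult_le_compat_r; lra.
    - replace (S * D) with ((S * D - n * t) + n * t) by ring.
      eapply Rle_trans; [apply Rabs_triang|]. rewrite (Rabs_mult n t).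
      assert (eta * Rabs t <= 1 * Rabs t) by (apply Rmult_le_compat_r; lra). lra. }
  apply Rmult_le_reg_l with A; [assumption|].
  replace (A * Rabs (D - n / A * t)) with (Rabs ((A - S) * D + (S * D - n * t))).
  2:{ rewrite <- (Rabs_pos_eq A) at 2 by lra. rewrite <- Rabs_mult. f_equal. field. lra. }
  eapply Rle_trans; [apply Rabs_triang|]. rewrite (Rabs_mult (A - S) D).
  apply Rle_trans with (eta * (B * Rabs t)).
  - assert (Rabs (A - S) * Rabs D <= eta * Rabs D).
    { apply Rmult_le_compat_r; [assumption|]. apply Rabs_le. lra. }
    assert (Rabs D <= (B - 1) * Rabs t).
    { apply Rmult_le_reg_l with (A / 2); [lra|].
      replace (A / 2 * ((B - 1) * Rabs t)) with ((Rabs n + 1) * Rabs t)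
        by (unfold B; field; lra). assumption. }
    assert (eta * Rabs D <= eta * ((B - 1) * Rabs t)) by (apply Rmult_le_compat_l; lra).
    lra.
  - apply Rle_trans with (e * A / B * (B * Rabs t)).
    + apply Rmult_le_compat_r; [apply Rmult_le_pos|]; lra.
    + right. field. lra.
Qed.

Variables (sigma : R) (V : R -> R).
Hypotheses (Hsigma : 0 <= sigma) (HV : profile_solution F G sigma V) (HV0 : V 0 = 0).

Let slope (p : R) : R := G p (V p).

Lemma slope_pos (p : R) : 0 < p < 1 -> 0 < slope p.
Proof. intros Hp. apply (G_pos F G HFG). now apply HV. Qed.

Lemma slope_continuous (p : R) : continuous slope p.
Proof.
  apply continuous_comp_2d; [apply (G_continuous F G HFG)|apply continuous_id|apply HV].
Qed.

(** The base point 1/2 fixes the translation: the wave takes the value 1/2 at the origin. *)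
Definition wave_coordinate (p : R) : R := RInt (fun r => / slope r) (1 / 2) p.

Lemma wave_coordinate_derive (p : R) : 0 < p < 1 -> is_derive wave_coordinate p (/ slope p).
Proof.
  intros Hp.
  assert (forall r, 0 < r < 1 -> continuous (fun r => / slope r) r) as Hc.
  { intros r Hr. apply (continuous_comp slope Rinv); [apply slope_continuous|].
    apply continuity_pt_filterlim, continuity_pt_inv; [apply continuity_pt_id|].
    pose proof (slope_pos r Hr). unfold id. lra. }
  apply (is_derive_RInt (V := R_NormedModule) (fun r => / slope r) _ (1 / 2) p); [|now apply Hc].
  apply filter_imp with (2 := locally_between 0 1 p Hp). intros b Hb.
  apply (RInt_correct (V := R_CompleteNormedModule)).
  apply (ex_RInt_continuous (V := R_CompleteNormedModule)). intros z Hz. apply Hc.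
  unfold Rmin, Rmax in Hz. destruct Rle_dec; lra.
Qed.

Lemma wave_coordinate_incr (p q : R) : 0 < p < 1 -> 0 < q < 1 -> p < q ->
  wave_coordinate p < wave_coordinate q.
Proof.
  intros Hp Hq Hpq.
  destruct (MVT_gen wave_coordinate p q (fun r => / slope r)) as [c [Hc E]];
    rewrite Rmin_left, Rmax_right in * by lra.
  - intros x Hx. apply wave_coordinate_derive. lra.
  - intros x Hx. apply continuity_pt_filterlim.
    apply (is_derive_continuous _ _ (/ slope x)), wave_coordinate_derive. lra.
  - assert (0 < / slope c * (q - p)); [|lra].
    apply Rmult_lt_0_compat; [|lra]. apply Rinv_0_lt_compat, slope_pos. lra.
Qed.

(** Dropping the positive quotient leaves V' <= sigma; integrated from 0, this is where [V 0 = 0]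
    enters. *)
Lemma V_le_near_0 (p : R) : 0 <= p < 1 -> V p <= sigma * p.
Proof.
  intros Hp. destruct HV as [Hc [_ HVd]].
  assert (sigma * 0 - V 0 <= sigma * p - V p); [|lra].
  assert (forall u, continuous (fun u => sigma * u) u) as Hc'.
  { intros u. apply (ex_derive_continuous (fun u => sigma * u)). auto_derive. exact I. }
  apply (derive_nonneg_le (fun u => sigma * u - V u)
    (fun u => sigma - (sigma - F u / G u (V u)))); [lra| | |].
  - intros u Hu. apply (is_derive_minus (V := R_NormedModule) (fun u => sigma * u)); [|apply HVd; lra].
    auto_derive; [exact I|ring].
  - intros u _. apply (continuous_minus (V := R_NormedModule)); [apply Hc'|apply Hc].
  - intros u Hu. assert (0 < F u / G u (V u)); [|lra].
    apply Rdiv_lt_0_compat; [apply (F_pos F G HFG); lra|].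
    apply (G_pos F G HFG), HVd. lra.
Qed.

(* For k large, k (1 - u) is a supersolution near u = 1, since f vanishes there at
   least linearly. *)
Lemma V_le_near_1 : exists k d, 0 < k /\ 0 < d /\
  forall p, 1 - d < p < 1 -> V p <= k * (1 - p).
Proof.
  assert (I01 1) as H1 by (unfold I01; lra).
  destruct (g_comparable w a f Hst HaC1 Ha_s Ha_plus 1 H1) as [c [C [r [Hc [HC [Hr Hg]]]]]].
  destruct (reaction_local_lipschitz w a f Hst 1 H1) as [K [d [HK [Hd Hf]]]].
  rewrite (reaction_1 w a f Hst) in Hf.
  assert (0 < K / c) as HKc by now apply Rdiv_lt_0_compat.
  (* At height [k (1 - u)] one has G >= c k (1 - u) = (K + c) (1 - u), which exceeds F, so the
     quotient is at most 1 and [sigma - 1 + k >= 0]. *)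
  set (k := K / c + 1). assert (1 <= k) as Hk by (unfold k; lra).
  assert (0 < r / k) as Hrk by (apply Rdiv_lt_0_compat; lra).
  set (e := Rmin (Rmin r d) (Rmin (r / k) 1)).
  assert (0 < e /\ e <= r /\ e <= d /\ e <= r / k /\ e <= 1) as He.
  { unfold e. pose proof (Rmin_l (Rmin r d) (Rmin (r / k) 1)).
    pose proof (Rmin_r (Rmin r d) (Rmin (r / k) 1)).
    pose proof (Rmin_l r d). pose proof (Rmin_r r d).
    pose proof (Rmin_l (r / k) 1). pose proof (Rmin_r (r / k) 1).
    assert (0 < Rmin (Rmin r d) (Rmin (r / k) 1)) by (repeat apply Rmin_pos; lra). lra. }
  exists k, e. split; [lra|]. split; [tauto|]. intros p Hp.
  destruct HV as [HVc [HV1 HVd]].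
  assert (forall u, continuous (fun u => k * (1 - u)) u) as Hc'.
  { intros u. apply (ex_derive_continuous (fun u => k * (1 - u))). auto_derive. exact I. }
  assert (V p - k * (1 - p) <= 0); [|lra].
  apply (comparison_continuous (fun u => V u - k * (1 - u))
    (fun u => (sigma - F u / G u (V u)) - - k) p 1); [lra| | | |lra].
  - intros u Hu. apply (is_derive_minus (V := R_NormedModule)); [apply HVd; lra|].
    auto_derive; [exact I|ring].
  - intros u Hu Hpos.
    assert (0 < k * (1 - u) < r) as Hku.
    { split; [apply Rmult_lt_0_compat; lra|].
      replace r with (k * (r / k)) by (field; lra). apply Rmult_lt_compat_l; lra. }
    pose proof (F_div_G_le F G HFG u (k * (1 - u)) (V u) ltac:(lra)).
    assert (F u / G u (k * (1 - u)) <= 1); [|lra].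
    assert (I01 u) as HI by (unfold I01; lra).
    assert (Rabs (u - 1) = 1 - u) as Habs by (rewrite Rabs_minus_sym; apply Rabs_pos_eq; lra).
    specialize (Hg u (k * (1 - u)) HI ltac:(lra) ltac:(lra)).
    specialize (Hf u HI ltac:(lra)). rewrite Habs, Rminus_0_r in Hf. pose proof (Rle_abs (f u)).
    unfold F, G. rewrite (clamped_ratio w a f) by assumption.
    assert (0 < c * (k * (1 - u))) by (apply Rmult_lt_0_compat; lra).
    apply Rmult_le_reg_r with (g w a u (k * (1 - u))); [lra|].
    unfold Rdiv at 1. rewrite Rmult_assoc, Rinv_l, Rmult_1_r, Rmult_1_l by lra.
    assert (K * (1 - u) <= c * (k * (1 - u))); [|lra].
    replace (c * (k * (1 - u))) with ((K + c) * (1 - u)) by (unfold k; field; lra).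
    apply Rmult_le_compat_r; lra.
  - apply (continuous_minus (V := R_NormedModule)); [apply HVc|apply Hc'].
Qed.

(** Makes the integrand [/ slope] at least a multiple of 1/|p - p0|, not integrable at [p0]: the
    wave needs infinite time to reach either end. *)
Lemma slope_linear_bound (p0 k d : R) : I01 p0 -> 0 < k -> 0 < d ->
  (forall p, 0 < p < 1 -> Rabs (p - p0) < d -> V p <= k * Rabs (p - p0)) ->
  exists C e, 0 < C /\ 0 < e /\
    forall p, 0 < p < 1 -> Rabs (p - p0) < e -> slope p <= C * Rabs (p - p0).
Proof.
  intros Hp0 Hk Hd HVk.
  destruct (g_comparable w a f Hst HaC1 Ha_s Ha_plus p0 Hp0) as [c [C [r [Hc [HC [Hr Hg]]]]]].
  assert (0 < r / k) as Hrk by now apply Rdiv_lt_0_compat.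
  exists (C * k), (Rmin d (Rmin r (r / k))).
  split; [now apply Rmult_lt_0_compat|]. split; [repeat apply Rmin_pos; assumption|].
  intros p Hp Hpd.
  pose proof (Rmin_l d (Rmin r (r / k))). pose proof (Rmin_r d (Rmin r (r / k))).
  pose proof (Rmin_l r (r / k)). pose proof (Rmin_r r (r / k)).
  assert (I01 p) as HI by (unfold I01; lra).
  specialize (HVk p Hp ltac:(lra)).
  assert (k * Rabs (p - p0) < r).
  { replace r with (k * (r / k)) by (field; lra). apply Rmult_lt_compat_l; lra. }
  destruct HV as [_ [_ HVd]]. destruct (HVd p Hp) as [HVpos _].
  destruct (Hg p (V p) HI ltac:(lra) ltac:(lra)) as [_ Hup].
  unfold slope, G, g_clamped. rewrite clamp_id by exact HI.
  rewrite Rmult_assoc. apply Rle_trans with (1 := Hup). apply Rmult_le_compat_l; lra.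
Qed.

Lemma wave_coordinate_unbounded_above (M : R) : exists p, 0 < p < 1 /\ M < wave_coordinate p.
Proof.
  destruct V_le_near_1 as [k [d [Hk [Hd HVk]]]].
  destruct (slope_linear_bound 1 k d) as [C [e [HC [He Hs]]]]; auto.
  { unfold I01; lra. }
  { intros p Hp Hpd. rewrite Rabs_minus_sym, Rabs_pos_eq in * by lra. apply HVk. lra. }
  set (t1 := Rmin e 1 / 2). pose proof (Rmin_l e 1). pose proof (Rmin_r e 1).
  assert (0 < Rmin e 1) by (apply Rmin_pos; lra).
  (* The substitution [t = 1 - p] moves the singular end to 0. *)
  destruct (log_divergence (fun t => wave_coordinate (1 - t)) (fun t => - / slope (1 - t)) (/ C) t1 M)
    as [t [Ht HM]].
  - now apply Rinv_0_lt_compat.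
  - unfold t1; lra.
  - intros t Ht. unfold t1 in Ht.
    replace (- / slope (1 - t)) with (scal (-1) (/ slope (1 - t)))
      by (unfold scal; simpl; unfold mult; simpl; ring).
    apply (is_derive_comp wave_coordinate (fun t => 1 - t)); [apply wave_coordinate_derive; lra|].
    auto_derive; [exact I|ring].
  - intros t Ht. unfold t1 in Ht. apply Ropp_le_contravar.
    assert (Rabs (1 - t - 1) = t) as Habs by (rewrite Rabs_minus_sym; rewrite Rabs_pos_eq; lra).
    specialize (Hs (1 - t) ltac:(lra) ltac:(lra)). rewrite Habs in Hs.
    unfold Rdiv. rewrite <- Rinv_mult. apply Rinv_le_contravar; [apply slope_pos; lra|assumption].
  - unfold t1 in Ht. exists (1 - t). split; [lra|assumption].
Qed.

Lemma wave_coordinate_unbounded_below (M : R) : exists p, 0 < p < 1 /\ wave_coordinate p < M.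
Proof.
  (* [sigma + 1] instead of [sigma], since a positive constant is required and [sigma = 0] is not
     excluded. *)
  destruct (slope_linear_bound 0 (sigma + 1) 1) as [C [e [HC [He Hs]]]]; try lra.
  { unfold I01; lra. }
  { intros p Hp _. rewrite Rminus_0_r, Rabs_pos_eq by lra.
    pose proof (V_le_near_0 p ltac:(lra)). lra. }
  set (t1 := Rmin e 1 / 2). pose proof (Rmin_l e 1). pose proof (Rmin_r e 1).
  assert (0 < Rmin e 1) by (apply Rmin_pos; lra).
  destruct (log_divergence (fun t => - wave_coordinate t) (fun t => - / slope t) (/ C) t1 (- M))
    as [t [Ht HM]].
  - now apply Rinv_0_lt_compat.
  - unfold t1; lra.
  - intros t Ht. unfold t1 in Ht.
    apply (is_derive_opp (V := R_NormedModule)), wave_coordinate_derive. lra.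
  - intros t Ht. unfold t1 in Ht. apply Ropp_le_contravar.
    assert (Rabs (t - 0) = t) as Habs by (rewrite Rminus_0_r; apply Rabs_pos_eq; lra).
    specialize (Hs t ltac:(lra) ltac:(lra)). rewrite Habs in Hs.
    unfold Rdiv. rewrite <- Rinv_mult. apply Rinv_le_contravar; [apply slope_pos; lra|assumption].
  - unfold t1 in Ht. exists t. split; lra.
Qed.

Lemma wave_coordinate_surjective (x : R) : exists p, 0 < p < 1 /\ wave_coordinate p = x.
Proof.
  destruct (wave_coordinate_unbounded_below x) as [p [Hp Hpx]].
  destruct (wave_coordinate_unbounded_above x) as [q [Hq Hqx]].
  assert (p < q) as Hpq.
  { destruct (Rtotal_order p q) as [|[->|H]]; [assumption|lra|].
    pose proof (wave_coordinate_incr q p Hq Hp H). lra. }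
  destruct (Ranalysis5.IVT_interv (fun r => wave_coordinate r - x) p q) as [r [Hr E]]; try lra.
  - intros r Hr. apply continuity_pt_filterlim.
    apply (continuous_minus (V := R_NormedModule)); [|apply continuous_const].
    apply (is_derive_continuous _ _ (/ slope r)), wave_coordinate_derive. lra.
  - exists r. split; lra.
Qed.

Definition wave (x : R) : R := epsilon (inhabits 0) (fun p => 0 < p < 1 /\ wave_coordinate p = x).

Lemma wave_spec (x : R) : 0 < wave x < 1 /\ wave_coordinate (wave x) = x.
Proof. unfold wave. apply epsilon_spec, wave_coordinate_surjective. Qed.

Lemma wave_coordinate_lt_inv (p q : R) : 0 < p < 1 -> 0 < q < 1 ->
  wave_coordinate p < wave_coordinate q -> p < q.
Proof.
  intros Hp Hq H. destruct (Rtotal_order p q) as [|[->|Hlt]]; [assumption|lra|].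
  pose proof (wave_coordinate_incr q p Hq Hp Hlt). lra.
Qed.

Lemma wave_incr (x y : R) : x < y -> wave x < wave y.
Proof.
  intros H. destruct (wave_spec x) as [H1 H2]. destruct (wave_spec y) as [H3 H4].
  apply wave_coordinate_lt_inv; auto. lra.
Qed.

Lemma wave_derive (x : R) : is_derive wave x (slope (wave x)).
Proof.
  rewrite <- (Rinv_inv (slope (wave x))). destruct (wave_spec x) as [Hx _].
  apply (is_derive_inverse wave_coordinate).
  - apply (continuous_inverse_increasing (fun p => 0 < p < 1) wave_coordinate).
    + intros p Hp. now apply locally_between.
    + apply wave_coordinate_incr.
    + apply filter_forall. exact wave_spec.
  - apply filter_forall. intros z. apply wave_spec.
  - now apply wave_coordinate_derive.
  - now apply Rinv_0_lt_compat, slope_pos.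
Qed.

Let h (x : R) : R := slope (wave x).

Lemma wave_Derive (x : R) : Derive wave x = h x.
Proof. apply is_derive_unique, wave_derive. Qed.

Lemma wave_h_continuous (x : R) : continuous h x.
Proof.
  apply (continuous_comp wave slope); [|apply slope_continuous].
  exact (is_derive_continuous _ _ _ (wave_derive x)).
Qed.

Lemma wave_h_spec (x : R) : Omega w (wave x, h x) /\ a (wave x) (h x) = V (wave x).
Proof.
  destruct (wave_spec x) as [Hx _]. assert (I01 (wave x)) as HI by (unfold I01; lra).
  unfold h, slope, G, g_clamped. rewrite clamp_id by exact HI.
  now apply (g_spec w a f Hst Ha_plus).
Qed.

(** Along the wave the flux is V(u), so its derivative V'(u) u' is sigma u' - f(u): the factor u' =
    g(u,V(u)) cancels the denominator. *)
Lemma profile_wave_flux_derive (x : R) :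
  is_derive (fun y => a (wave y) (h y)) x (sigma * h x - f (wave x)).
Proof.
  apply is_derive_ext with (fun y => V (wave y)).
  { intros y. symmetry. apply wave_h_spec. }
  destruct (wave_spec x) as [Hx _]. destruct HV as [_ [_ HVd]].
  replace (sigma * h x - f (wave x)) with
    (scal (h x) (sigma - F (wave x) / G (wave x) (V (wave x)))).
  - apply (is_derive_comp V wave); [now apply HVd|apply wave_derive].
  - unfold scal; simpl; unfold mult; simpl.
    change (G (wave x) (V (wave x))) with (h x).
    unfold F, reaction_clamped. rewrite clamp_id by lra.
    pose proof (slope_pos (wave x) Hx). field. change (h x <> 0). unfold h. lra.
Qed.

(** Differentiating the flux along the wave implicitly gives u'' = (sigma u' - f - u' a_u) / a_s, a
    continuous expression because [wave] stays in (0,1) and the partial derivatives are continuous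
    on [Omega]. *)
Lemma wave_C2 : C2_R wave.
Proof.
  destruct HaC1 as [[a_u [Ha_u Ha_uc]] [_ Ha_sc]].
  set (k := fun x => (sigma * h x - f (wave x) - h x * a_u (wave x) (h x))
                     * / Derive (fun r => a (wave x) r) (h x)).
  assert (forall x, is_derive (Derive wave) x (k x)) as Hk.
  { intros x. apply is_derive_ext with h; [intros y; symmetry; apply wave_Derive|].
    destruct (wave_spec x) as [Hx _]. destruct (wave_h_spec x) as [HO _].
    apply (implicit_derive wave h x (h x) (sigma * h x - f (wave x)) (a_u (wave x) (h x))).
    - intros y. apply wave_h_spec.
    - assumption.
    - apply wave_derive.
    - apply wave_h_continuous.
    - apply profile_wave_flux_derive.
    - apply derive_within_interior; auto. }
  intros x. split; [exists (h x); apply wave_derive|]. split; [now exists (k x)|].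
  apply continuous_ext with k; [intros y; symmetry; apply is_derive_unique, Hk|].
  pose proof (is_derive_continuous _ _ _ (wave_derive x)) as Hwc.
  pose proof (wave_h_continuous x) as Hhc.
  assert (forall y, Omega w (wave y, h y)) as HO by apply wave_h_spec.
  apply (continuous_mult (K := R_AbsRing)
    (fun x => sigma * h x - f (wave x) - h x * a_u (wave x) (h x))
    (fun x => / Derive (fun r => a (wave x) r) (h x))).
  - apply (continuous_minus (V := R_NormedModule) (fun x => sigma * h x - f (wave x))
      (fun x => h x * a_u (wave x) (h x))).
    + apply (continuous_minus (V := R_NormedModule) (fun x => sigma * h x) (fun x => f (wave x))).
      * apply (continuous_scal_r (K := R_AbsRing) (V := R_NormedModule) sigma h), Hhc.
      * apply continuous_ext with (fun y => F (wave y)).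
        { intros y. destruct (wave_spec y). unfold F, reaction_clamped. now rewrite clamp_id by lra. }
        apply (continuous_comp wave F); [assumption|apply (F_continuous F G HFG)].
    + apply (continuous_mult (K := R_AbsRing) h (fun x => a_u (wave x) (h x))); [assumption|].
      now apply (continuous_on_Omega_comp (fun p => a_u (fst p) (snd p)) wave h).
  - apply (continuous_comp (fun x => Derive (fun r => a (wave x) r) (h x)) Rinv).
    + now apply (continuous_on_Omega_comp (fun p => Derive (fun r => a (fst p) r) (snd p)) wave h).
    + apply continuity_pt_filterlim, continuity_pt_inv; [apply continuity_pt_id|].
      pose proof (Ha_s _ _ (HO x)). unfold id. lra.
Qed.

Lemma wave_lim_m_infty : is_lim wave m_infty 0.
Proof.
  apply is_lim_spec. intros e. pose proof (cond_pos e).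
  set (p := Rmin e 1 / 2). pose proof (Rmin_l e 1). pose proof (Rmin_r e 1).
  assert (0 < Rmin e 1) by (apply Rmin_pos; lra).
  exists (wave_coordinate p). intros x Hx. destruct (wave_spec x) as [Hw1 Hw2].
  assert (wave x < p) as Hlt.
  { apply wave_coordinate_lt_inv; [assumption|unfold p; lra|lra]. }
  unfold p in Hlt. apply Rabs_def1; lra.
Qed.

Lemma wave_lim_p_infty : is_lim wave p_infty 1.
Proof.
  apply is_lim_spec. intros e. pose proof (cond_pos e).
  set (p := 1 - Rmin e 1 / 2). pose proof (Rmin_l e 1). pose proof (Rmin_r e 1).
  assert (0 < Rmin e 1) by (apply Rmin_pos; lra).
  exists (wave_coordinate p). intros x Hx. destruct (wave_spec x) as [Hw1 Hw2].
  assert (p < wave x) as Hlt.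
  { apply wave_coordinate_lt_inv; [unfold p; lra|assumption|lra]. }
  unfold p in Hlt. apply Rabs_def1; lra.
Qed.

Lemma wave_flux_Derive_form (x : R) :
  is_derive (fun y => a (wave y) (Derive wave y)) x (sigma * h x - f (wave x)).
Proof.
  apply is_derive_ext with (fun y => a (wave y) (h y)); [|apply profile_wave_flux_derive].
  intros y. now rewrite wave_Derive.
Qed.

Lemma wave_classic_profile : classic_profile w a f sigma wave.
Proof.
  split; [apply wave_C2|]. split; [apply wave_incr|].
  split; [intros x; destruct (wave_spec x); lra|].
  split; [intros x; rewrite wave_Derive; apply wave_h_spec|].
  split; [apply wave_lim_m_infty|]. split; [apply wave_lim_p_infty|].
  intros x. split; [eexists; apply wave_flux_Derive_form|].
  rewrite (is_derive_unique (fun y : R => a (wave y) (Derive wave y)) _ _ (wave_flux_Derive_form x)),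
    wave_Derive. ring.
Qed.

Lemma is_derive_shift (k : R -> R) (c x l : R) :
  is_derive k (x + c) l -> is_derive (fun y => k (y + c)) x l.
Proof.
  intros H. replace l with (scal 1 l) by (unfold scal; simpl; unfold mult; simpl; ring).
  apply (is_derive_comp k (fun y => y + c)); [assumption|]. auto_derive; [exact I|ring].
Qed.

Lemma wave_solves_equation : solves_equation a f (fun t x => wave (x + sigma * t)).
Proof.
  intros t x. set (z := x + sigma * t).
  assert (is_derive (fun tau => wave (x + sigma * tau)) t (sigma * h z)) as H1.
  { apply (is_derive_comp wave (fun tau => x + sigma * tau) t (h z) sigma); [apply wave_derive|].
    auto_derive; [exact I|ring]. }
  assert (forall y, is_derive (fun y => wave (y + sigma * t)) y (h (y + sigma * t))) as H2.
  { intros y. apply (is_derive_shift wave), wave_derive. }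
  assert (is_derive (fun y => a (wave (y + sigma * t)) (Derive (fun z => wave (z + sigma * t)) y)) x
    (sigma * h z - f (wave z))) as H3.
  { apply is_derive_ext with (fun y => a (wave (y + sigma * t)) (h (y + sigma * t))).
    - intros y. now rewrite (is_derive_unique (fun z : R => wave (z + sigma * t)) _ _ (H2 y)).
    - apply (is_derive_shift (fun y => a (wave y) (h y))), profile_wave_flux_derive. }
  split; [now exists (sigma * h z)|]. split; [exists (h z); apply H2|].
  split; [now exists (sigma * h z - f (wave z))|].
  rewrite (is_derive_unique (fun tau : R => wave (x + sigma * tau)) _ _ H1),
    (is_derive_unique (fun y : R => a (wave (y + sigma * t)) (Derive (fun z => wave (z + sigma * t)) y)) _ _ H3).
  fold z. ring.
Qed.

Lemma profile_has_classic_travelling_wave : has_classic_travelling_wave w a f sigma.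
Proof. exists wave. split; [apply wave_classic_profile|apply wave_solves_equation]. Qed.

End ProfileGivesWave.

Theorem mainTheorem2 (w : R -> Rbar) (a : R -> R -> R) (f : R -> R)
  (Hstanding : standing_assumptions w a f)
  (HaC1 : C1_Omega w a)
  (Ha_s : forall u s, Omega w (u, s) -> 0 < Derive (fun r => a u r) s)
  (Ha_plus : forall u, I01 u -> a_plus w a u = p_infty) :
  Rbar_continuous_01 (a_plus w a)
  /\ (forall sigma, 0 <= sigma -> is_alpha w a f sigma 0)
  /\ exists sigma_s : R,
       is_sigma_s w a f sigma_s
       /\ sigma_r w a f = Finite sigma_s
       /\ (forall sigma : R,
             has_classic_travelling_wave w a f sigma <-> sigma_s <= sigma).
Proof.
  split; [|split].
  (* The upper semicontinuous half is vacuous: nothing exceeds [p_infty]. *)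
  - split; intros u Hu c Hc; rewrite Ha_plus in Hc by assumption; [|contradiction].
    unfold within. apply filter_forall. intros v Hv. now rewrite Ha_plus.
  - intros sigma. now apply is_alpha_0.
  - pose proof (clamped_regular_data w a f Hstanding Ha_plus) as HFG.
    destruct (ratio_on_diagonal_bounded w a f Hstanding HaC1 Ha_s Ha_plus) as [B [HB0 HB]].
    destruct (minimal_speed_exists _ _ HFG B HB0 HB) as [m [Hm0 Hm]].
    exists m. split; [|split].
    + split.
      * apply vanishing_speed_calV; auto. apply Hm, Rle_refl.
      * intros x Hx. apply Hm. now apply vanishing_speed_calV.
    + now apply sigma_r_eq.
    (* Negative speeds are covered too: a wave forces [sigma > 0]. *)
    + intros sigma. rewrite <- Hm. split.
      * intros [u [Hu _]]. now apply classic_profile_vanishing_speed with u.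
      * intros [Hs [V [HV HV0]]]. now apply profile_has_classic_travelling_wave with V.
Qed.
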